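(* Let $M$ be a connected smooth Riemannian manifold without boundary and let $q\in(1,\infty)$. If $M$ admits a sequence of Laplacian cut-off functions and satisfies the $L^q$-Calderon-Zygmund inequality, then $C^\infty_c(M)$ is dense in $H^{2,q}(M)$.
   Context: $\Delta$ is the (negative) Laplace-Beltrami operator, $\nabla$ the Levi-Civita connection, and $\nabla d\Psi$ the Hessian of a function $\Psi$. $L^q$-norms $\|\cdot\|_q$ are taken with respect to the Riemannian volume measure, using the pointwise norms on tensors induced by the metric. Functions are complex-valued and tensorial data are complexified. A sequence of Laplacian cut-off functions on $M$ is a sequence $(\chi_n)\subset C^\infty_c(M)$ such that: (C1) $0\le\chi_n(x)\le1$ for all $n\in\mathbb N$, $x\in M$; (C2) for every compact $K\subset M$ there is $n_0(K)\in\mathbb N$ with $\chi_n|_K=1$ for all $n\ge n_0(K)$; (C3) $\sup_{x\in M}|d\chi_n(x)|_x\to0$ as $n\to\infty$; (C4) $\sup_{x\in M}|\Delta\chi_n(x)|\to0$ as $n\to\infty$. $M$ satisfies the $L^q$-Calderon-Zygmund inequality if there are constants $C_q>0$, $D_q\ge0$ such that $\|\nabla d\Psi\|_q\le C_q\|\Delta\Psi\|_q+D_q\|\Psi\|_q$ for all $\Psi\in C^\infty_c(M)$. $H^{2,q}(M)\subset L^q(M)$ is the Sobolev (Banach) space given by the closure (completion) of $\{\Psi\in C^\infty(M)\cap L^q(M): |d\Psi|,|\nabla d\Psi|\in L^q(M)\}$ with respect to the norm $\|\Psi\|_{2,q}:=\|\Psi\|_q+\|d\Psi\|_q+\|\nabla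 d\Psi\|_q$. *)

(* Defs.v *)
From HB Require Import structures.
From mathcomp Require Import all_boot all_order all_algebra.
From mathcomp Require Import all_classical all_reals all_analysis.
From mathcomp Require Import complex.

Set Implicit Arguments.
Unset Strict Implicit.
Unset Printing Implicit Defensive.

Import Order.TTheory GRing.Theory Num.Theory.
Import numFieldNormedType.Exports.

Local Open Scope classical_set_scope.
Local Open Scope ring_scope.

Section Euclidean.
Context {R : realType}.

Definition partial {m : nat} (j : 'I_m) (f : 'rV[R]_m -> R) : 'rV[R]_m -> R :=
  fun y => 'D_(delta_mx 0 j) f y.

Fixpoint Ck_on {m : nat} (k : nat) (U : set 'rV[R]_m) (f : 'rV[R]_m -> R) :
    Prop :=
  {in U, continuous f} /\
  if k is k'.+1 then
    forall j, (forall y, U y -> derivable f y (delta_mx 0 j)) /\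
              Ck_on k' U (partial j f)
  else True.

(* Only used for open U. *)
Definition smooth_on {m : nat} (U : set 'rV[R]_m) (f : 'rV[R]_m -> R) : Prop :=
  forall k, Ck_on k U f.

(* Integral over R^m with respect to m-dimensional Lebesgue measure, as an
   iterated integral; by Tonelli the two agree on nonnegative Borel functions,
   the only ones to which it is applied. *)
Fixpoint lebesgue_int (m : nat) : ('rV[R]_m -> \bar R) -> \bar R :=
  match m with
  | 0 => fun f => f 0
  | m'.+1 => fun f => (\int[lebesgue_measure]_(t in [set: R])
      lebesgue_int (fun v : 'rV[R]_m' => f (row_mx (t%:M : 'rV[R]_1) v)))%E
  end.

Section LeviCivita.
Context {m : nat} (g : 'rV[R]_m -> 'M[R]_m).
Implicit Types (f : 'rV[R]_m -> R) (y : 'rV[R]_m) (i j k l : 'I_m).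

(* Christoffel symbol Gamma^k_(ij) of the Levi-Civita connection of g. *)
Definition christoffel k i j y : R :=
  2^-1 * \sum_l invmx (g y) k l *
    (partial i (fun z => g z j l) y + partial j (fun z => g z i l) y
     - partial l (fun z => g z i j) y).

Definition differential f y : 'rV[R]_m := \row_j partial j f y.

Definition hessian f y : 'M[R]_m := \matrix_(i, j)
  (partial i (partial j f) y - \sum_k christoffel k i j y * partial k f y).

Definition gradient f y : 'rV[R]_m :=
  \row_i \sum_j invmx (g y) i j * partial j f y.

(* div V is the trace of the covariant derivative of V. *)
Definition divergence (V : 'rV[R]_m -> 'rV[R]_m) y : R :=
  \sum_i (partial i (fun z => V z 0 i) y
          + \sum_j christoffel i i j y * V y 0 j).

Definition laplacian f y : R := divergence (gradient f) y.

(* Squared norms induced by g: |a|^2 = g^(ij) a_i a_j on covectors and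
   |T|^2 = g^(ik) g^(jl) T_ij T_kl on covariant 2-tensors. *)
Definition sqnorm1 y (a : 'rV[R]_m) : R :=
  \sum_i \sum_j invmx (g y) i j * a 0 i * a 0 j.

Definition sqnorm2 y (T : 'M[R]_m) : R :=
  \sum_i \sum_j \sum_k \sum_l
    invmx (g y) i k * invmx (g y) j l * T i j * T k l.

End LeviCivita.
End Euclidean.

Section Manifold.
Context {R : realType} {m : nat}.

(* A homeomorphism cmap from the open set cdom onto an open set of R^m, with
   inverse cinv; values of cmap and cinv outside these sets are irrelevant. *)
Record chart (M : topologicalType) := Chart {
  cdom : set M;
  cmap : M -> 'rV[R]_m;
  cinv : 'rV[R]_m -> M;
  cdom_open : open cdom;
  cimg_open : open (cmap @` cdom);
  cmap_continuous : {in cdom, continuous cmap};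
  cinv_continuous : {in cmap @` cdom, continuous cinv};
  cmapK : {in cdom, cancel cmap cinv} }.

Definition cimg (M : topologicalType) (c : chart M) : set 'rV[R]_m :=
  cmap c @` cdom c.

Definition transition (M : topologicalType) (c c' : chart M) :
    'rV[R]_m -> 'rV[R]_m := fun y => cmap c' (cinv c y).

(* A smooth structure, given by an atlas, together with a Riemannian metric,
   given by its coordinate matrices: metric i y = (g_ab) at the point with
   coordinates y in the chart i. Indexing the atlas by nat expresses second
   countability; charts may be repeated or empty. *)
Record riemannian (M : topologicalType) := Riemannian {
  atlas : nat -> chart M;
  atlas_cover : forall x : M, exists i, cdom (atlas i) x;
  atlas_smooth : forall i j (a : 'I_m),
    smooth_on (cmap (atlas i) @` (cdom (atlas i) `&` cdom (atlas j)))
      (fun y => transition (atlas i) (atlas j) y 0 a);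
  metric : nat -> 'rV[R]_m -> 'M[R]_m;
  metric_smooth : forall i (a b : 'I_m),
    smooth_on (cimg (atlas i)) (fun y => metric i y a b);
  metric_sym : forall i y, cimg (atlas i) y -> (metric i y)^T = metric i y;
  metric_pos : forall i y (v : 'rV[R]_m), cimg (atlas i) y -> v != 0 ->
    0 < (v *m metric i y *m v^T) 0 0;
  metric_change : forall i j y,
    (cmap (atlas i) @` (cdom (atlas i) `&` cdom (atlas j))) y ->
    let tau := transition (atlas i) (atlas j) in
    let J := \matrix_(a, b) partial a (fun z => tau z 0 b) y in
    metric i y = J *m metric j (tau y) *m J^T }.

End Manifold.

Arguments chart R m M : clear implicits.
Arguments riemannian R m M : clear implicits.

Section Calculus.
Context {R : realType} {m : nat} {M : topologicalType} (g : riemannian R m M).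
Implicit Types (f : M -> R) (h : M -> R[i]) (x : M).

Definition smooth f : Prop :=
  forall i, smooth_on (cimg (atlas g i)) (f \o cinv (atlas g i)).

(* At x, the tensors df and Hess f and the number Delta f are computed in the
   first chart of the atlas around x. Their norms, and Delta f, are invariant
   under changes of chart, so that this choice does not matter. *)
Lemma chart_exists x : exists i, `[< cdom (atlas g i) x >].
Proof. by have [i ix] := atlas_cover g x; exists i; apply/asboolP. Qed.

Definition chart_at x : nat := ex_minn (chart_exists x).

Definition coord x : 'rV[R]_m := cmap (atlas g (chart_at x)) x.

Definition local f x : 'rV[R]_m -> R := f \o cinv (atlas g (chart_at x)).

Definition metric_at x : 'rV[R]_m -> 'M[R]_m := metric g (chart_at x).

Definition sqnorm_d f x : R :=
  sqnorm1 (metric_at x) (coord x) (differential (local f x) (coord x)).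

Definition sqnorm_hess f x : R :=
  sqnorm2 (metric_at x) (coord x) (hessian (metric_at x) (local f x) (coord x)).

Definition lap f x : R := laplacian (metric_at x) (local f x) (coord x).

Definition norm_d f x : R := Num.sqrt (sqnorm_d f x).

Definition re h : M -> R := fun x => complex.Re (h x).
Definition im h : M -> R := fun x => complex.Im (h x).

Definition csmooth h : Prop := smooth (re h) /\ smooth (im h).

Definition ctest h : Prop := csmooth h /\ compact (closure [set x | h x != 0]).

(* Pointwise norms of h, Delta h, dh and Hess h; the norm of a complexified
   tensor is the Hermitian one, |S + iT|^2 = |S|^2 + |T|^2. *)
Definition cnorm h x : R := Normc.normc (h x).
Definition cnorm_lap h x : R :=
  Num.sqrt (lap (re h) x ^+ 2 + lap (im h) x ^+ 2).
Definition cnorm_d h x : R := Num.sqrt (sqnorm_d (re h) x + sqnorm_d (im h) x).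
Definition cnorm_hess h x : R :=
  Num.sqrt (sqnorm_hess (re h) x + sqnorm_hess (im h) x).

Definition laplacian_cutoffs (chi : nat -> M -> R) : Prop :=
  [/\ forall n, smooth (chi n) /\ compact (closure [set x | chi n x != 0]),
      forall n x, 0 <= chi n x <= 1,
      forall K : set M, compact K ->
        exists n0, forall n, (n0 <= n)%N -> forall x, K x -> chi n x = 1,
      ereal_sup [set (norm_d (chi n) x)%:E | x in [set: M]]
        @[n --> \oo] --> 0%E &
      ereal_sup [set `|lap (chi n) x|%:E | x in [set: M]]
        @[n --> \oo] --> 0%E ].

End Calculus.

Notation borel M := (g_sigma_algebraType (@open M)).

Section Sobolev.
Context {R : realType} {m : nat} {M : ptopologicalType} (g : riemannian R m M).

(* In a chart the volume measure has density sqrt (det g) with respect to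
   Lebesgue measure; this determines it. *)
Definition volume_measure (mu : {measure set (borel M) -> \bar R}) : Prop :=
  forall i (A : set (borel M)), measurable A -> A `<=` cdom (atlas g i) ->
    mu A = lebesgue_int (fun y : 'rV[R]_m =>
      (\1_(cmap (atlas g i) @` A) y * Num.sqrt (\det (metric g i y)))%:E).

Context (mu : {measure set (borel M) -> \bar R}) (q : R).
Local Open Scope ereal_scope.

Implicit Types h u : M -> R[i].

Definition Lq (F : M -> R) : \bar R := 'N[mu]_(q%:E)[EFin \o F].

Definition calderon_zygmund : Prop :=
  exists C D : R, [/\ (0 < C)%R, (0 <= D)%R & forall h, ctest g h ->
    Lq (cnorm_hess g h) <= C%:E * Lq (cnorm_lap g h) + D%:E * Lq (cnorm h)].

Definition norm2q h : \bar R :=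
  Lq (cnorm h) + Lq (cnorm_d g h) + Lq (cnorm_hess g h).

(* The smooth functions whose completion is H^{2,q}. *)
Definition smooth2q h : Prop :=
  [/\ csmooth g h, Lq (cnorm h) < +oo, Lq (cnorm_d g h) < +oo
    & Lq (cnorm_hess g h) < +oo].

Definition in_Lq u : Prop :=
  [/\ measurable_fun [set: borel M] (re u : borel M -> R),
      measurable_fun [set: borel M] (im u : borel M -> R)
    & Lq (cnorm u) < +oo].

(* The completion of smooth2q for norm2q. An element is given by a Cauchy
   sequence H2q_seq; H2q_fun is its limit in L^q, the function to which the
   inclusion of H^{2,q} in L^q sends it. Elements at distance 0 are equal. *)
Record H2q := MkH2q {
  H2q_seq : nat -> M -> R[i];
  H2q_fun : M -> R[i];
  H2q_smooth : forall k, smooth2q (H2q_seq k);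
  H2q_cauchy : forall e : R, (0 < e)%R -> exists N, forall j k, (N <= j)%N ->
    (N <= k)%N -> norm2q (fun x => H2q_seq j x - H2q_seq k x)%R < e%:E;
  H2q_fun_Lq : in_Lq H2q_fun;
  H2q_limit :
    Lq (cnorm (fun x => H2q_seq k x - H2q_fun x)%R) @[k --> \oo] --> 0 }.

(* Distance in H^{2,q} from w to the image of the smooth function h, that is,
   to the element with constant sequence h. *)
Definition H2q_dist (w : H2q) h : \bar R :=
  limn (fun k => norm2q (fun x => H2q_seq w k x - h x)%R).

Definition dense_in_H2q (A : (M -> R[i]) -> Prop) : Prop :=
  forall (w : H2q) (e : R), (0 < e)%R ->
    exists h, [/\ A h, smooth2q h & H2q_dist w h < e%:E].

End Sobolev.

(* Main.v *)
Require Import Defs.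
From mathcomp Require Import all_boot all_order all_algebra.
From mathcomp Require Import all_classical all_reals all_analysis.
From mathcomp Require Import measurable_realfun.
From mathcomp Require Import complex.
From mathcomp Require Import ring lra.

(* For h in the pre-completion of H^{2,q}, the truncations chi_n h converge to
   h. Dominated convergence and (C3) give ||(1 - chi_n) h||_q -> 0 and
   ||d((1 - chi_n) h)||_q -> 0. The Hessian of chi_n is not controlled
   pointwise, so the Calderon-Zygmund inequality is applied to the compactly
   supported functions (chi_j - chi_n) h instead: by the Leibniz rule
     |Delta(eta h)| <= |eta| |Delta h| + 2 |d eta| |dh| + |Delta eta| |h|,
   together with |Delta h| <= sqrt m |Hess h|, (C3) and (C4), the Hessians of
   chi_n h are Cauchy in L^q. Near every point chi_j is eventually 1, hence
   Fatou's lemma as j -> oo bounds the L^q norm of Hess((1 - chi_n) h). *)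

Set Implicit Arguments.
Unset Strict Implicit.
Unset Printing Implicit Defensive.
Import Order.TTheory GRing.Theory Num.Theory.
Import numFieldNormedType.Exports.

Local Open Scope classical_set_scope.
Local Open Scope ring_scope.

(* mathcomp.algebra.vector also defines coord. *)
Local Notation coord := Defs.coord.

(** * Smooth functions on open subsets of R^m *)

(** Four obstacles lie outside the analysis. The norms [sqnorm1] and [sqnorm2] are index sums
    against the inverse metric; factoring that inverse as [B *m B^T] at each point turns them into
    Euclidean norms, and the tensor inequalities into those of Minkowski and Cauchy-Schwarz, with
    real and imaginary parts stacked in one vector. The Laplacian is defined as the divergence of
    the gradient, whereas the space controls only the Hessian; hence the coordinate proof that it is
    the metric trace of the Hessian. Convergence of Hessians at a point needs [chi j] to be 1 near
    that point and not only at it, which (C2) yields through local compactness. Finally, tensors at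
    [x] are computed in a chart that jumps with [x], so that measurability is obtained on countably
    many pieces, on each of which the chart is fixed. In the Leibniz rule the mixed term is harmless
    because [|dh|] in L^q belongs to the definition of the space. *)

Section SmoothOn.
Context {R : realType} {m : nat}.
Implicit Types (U : set 'rV[R]_m) (f g : 'rV[R]_m -> R) (j : 'I_m).

Lemma Ck_onW k U f : Ck_on k.+1 U f -> Ck_on k U f.
Proof.
elim: k f => [|k IH] f [cf df]; first by split.
split => // j; have [dfj Cj] := df j; split => //; exact: IH.
Qed.

Lemma eq_partial U f g j y : open U -> U y -> {in U, f =1 g} ->
  partial j f y = partial j g y.
Proof.
move=> oU Uy fg; apply: near_eq_derive.
by apply: filterS (open_nbhs_nbhs (conj oU Uy)) => z Uz; apply: fg; rewrite inE.
Qed.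

Lemma eq_derivable_on U f g v y : open U -> U y -> {in U, f =1 g} ->
  derivable f y v -> derivable g y v.
Proof.
move=> oU Uy fg; apply: near_eq_derivable.
by apply: filterS (open_nbhs_nbhs (conj oU Uy)) => z Uz; apply: fg; rewrite inE.
Qed.

(** Since [U] is open, agreement on [U] is agreement near each of its points, which is all that
    derivatives see. This lets the rules below replace a partial derivative by a formula valid on
    [U] only. *)
Lemma eq_Ck_on k U f g : open U -> {in U, f =1 g} -> Ck_on k U f -> Ck_on k U g.
Proof.
move=> oU; have cont f' g' : {in U, f' =1 g'} -> {in U, continuous f'} ->
    {in U, continuous g'}.
  move=> fg cf y yU; have := cf y yU; rewrite /continuous_at (fg y yU).
  apply: cvg_trans; rewrite inE in yU.
  apply: (@near_eq_cvg _ _ (nbhs y) (nbhs_filter y)).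
  by apply: filterS (open_nbhs_nbhs (conj oU yU)) => z Uz; rewrite fg// inE.
elim: k f g => [|k IH] f g fg [cf df]; split; [exact: cont fg cf|by []| |].
  exact: cont fg cf.
move=> j; have [dfj Cj] := df j; split=> [y Uy|].
  exact: eq_derivable_on oU Uy fg (dfj _ Uy).
by apply: IH Cj => y; rewrite inE => Uy; exact: eq_partial oU Uy fg.
Qed.

Lemma partialD f g j y : derivable f y (delta_mx 0 j) ->
  derivable g y (delta_mx 0 j) ->
  partial j (fun z => f z + g z) y = partial j f y + partial j g y.
Proof. exact: deriveD. Qed.

Lemma partialM f g j y : derivable f y (delta_mx 0 j) ->
  derivable g y (delta_mx 0 j) ->
  partial j (fun z => f z * g z) y = f y * partial j g y + g y * partial j f y.
Proof. by move=> df dg; rewrite /partial (deriveM df dg). Qed.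

Lemma partialN f j y : derivable f y (delta_mx 0 j) ->
  partial j (fun z => - f z) y = - partial j f y.
Proof. exact: deriveN. Qed.

Lemma Ck_on_cst k U (c : R) : Ck_on k U (cst c).
Proof.
elim: k c => [|k IH] c; split => //.
1,2: by move=> y _; exact: cst_continuous.
move=> j; split=> [y _|]; first exact: (@derivable_cst R _ _ c y).
have -> : partial j (cst c) = cst 0 by apply/funext => y; exact: derive_cst.
exact: IH.
Qed.

Lemma Ck_onD k U f g : open U -> Ck_on k U f -> Ck_on k U g ->
  Ck_on k U (fun y => f y + g y).
Proof.
move=> oU; elim: k f g => [|k IH] f g [cf df] [cg dg]; split => //.
1,2: by move=> y yU; exact: (continuousD (cf y yU) (cg y yU)).
move=> j; have [dfj Cfj] := df j; have [dgj Cgj] := dg j; split=> [y Uy|].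
  by apply: derivableD; [exact: dfj|exact: dgj].
apply: (@eq_Ck_on _ _ (fun y => partial j f y + partial j g y)) => //; last exact: IH.
move=> y; rewrite inE => Uy; rewrite partialD//; [exact: dfj|exact: dgj].
Qed.

Lemma Ck_onM k U f g : open U -> Ck_on k U f -> Ck_on k U g ->
  Ck_on k U (fun y => f y * g y).
Proof.
move=> oU; elim: k f g => [|k IH] f g Cf Cg; have [cf df] := Cf; have [cg dg] := Cg;
  split => //.
1,2: by move=> y yU; exact: (continuousM (cf y yU) (cg y yU)).
move=> j; have [dfj Cfj] := df j; have [dgj Cgj] := dg j; split=> [y Uy|].
  by apply: derivableM; [exact: dfj|exact: dgj].
apply: (@eq_Ck_on _ _ (fun y => f y * partial j g y + g y * partial j f y)) => //.
  move=> y; rewrite inE => Uy; rewrite partialM//; [exact: dfj|exact: dgj].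
by apply: Ck_onD => //; apply: IH => //; exact: Ck_onW.
Qed.

Lemma Ck_onV k U f : open U -> (forall y, U y -> f y != 0) -> Ck_on k U f ->
  Ck_on k U (fun y => (f y)^-1).
Proof.
move=> oU f0; elim: k => [|k IH] Cf; have [cf df] := Cf; split => //.
1,2: by move=> y yU; apply: (continuousV _ (cf y yU)); apply: f0; rewrite inE in yU.
move=> j; have [dfj Cfj] := df j; split=> [y Uy|].
  by apply: derivableV; [exact: f0|exact: dfj].
apply: (@eq_Ck_on _ _ (fun y => (-1 * ((f y)^-1 * (f y)^-1)) * partial j f y)) => //.
  move=> y; rewrite inE => Uy; rewrite /partial deriveV; [|exact: f0|exact: dfj].
  by rewrite -exprVn expr2 /GRing.scale/= mulN1r.
apply: Ck_onM => //; apply: Ck_onM => //; first exact: Ck_on_cst.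
by apply: Ck_onM => //; apply: IH; exact: Ck_onW.
Qed.

Lemma eq_smooth_on U f g : open U -> {in U, f =1 g} -> smooth_on U f ->
  smooth_on U g.
Proof. by move=> oU fg sf k; exact: eq_Ck_on oU fg (sf k). Qed.

Lemma smooth_on_cst U (c : R) : smooth_on U (cst c).
Proof. by move=> k; exact: Ck_on_cst. Qed.

Lemma smooth_onD U f g : open U -> smooth_on U f -> smooth_on U g ->
  smooth_on U (fun y => f y + g y).
Proof. by move=> oU sf sg k; exact: Ck_onD. Qed.

Lemma smooth_onM U f g : open U -> smooth_on U f -> smooth_on U g ->
  smooth_on U (fun y => f y * g y).
Proof. by move=> oU sf sg k; exact: Ck_onM. Qed.

Lemma smooth_onN U f : open U -> smooth_on U f -> smooth_on U (fun y => - f y).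
Proof.
move=> oU sf; apply: (@eq_smooth_on U (fun y => -1 * f y)) => //.
  by move=> y _; rewrite mulN1r.
by apply: smooth_onM => //; exact: smooth_on_cst.
Qed.

Lemma smooth_onB U f g : open U -> smooth_on U f -> smooth_on U g ->
  smooth_on U (fun y => f y - g y).
Proof. by move=> oU sf sg; apply: smooth_onD => //; exact: smooth_onN. Qed.

Lemma smooth_onV U f : open U -> (forall y, U y -> f y != 0) ->
  smooth_on U f -> smooth_on U (fun y => (f y)^-1).
Proof. by move=> oU f0 sf k; exact: Ck_onV. Qed.

Lemma smooth_on_sum U (I : Type) (r : seq I) (P : pred I)
    (F : I -> 'rV[R]_m -> R) : open U ->
  (forall i, P i -> smooth_on U (F i)) ->
  smooth_on U (fun y => \sum_(i <- r | P i) F i y).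
Proof.
move=> oU sF; elim: r => [|i r IH].
  apply: (@eq_smooth_on U (cst 0)) => //; last exact: smooth_on_cst.
  by move=> y _; rewrite big_nil.
case Pi : (P i); last first.
  by apply: eq_smooth_on IH => // y _; rewrite big_cons Pi.
apply: (@eq_smooth_on U (fun y => F i y + \sum_(i <- r | P i) F i y)) => //.
  by move=> y _; rewrite big_cons Pi.
by apply: smooth_onD => //; exact: sF.
Qed.

Lemma smooth_on_prod U (I : Type) (r : seq I) (P : pred I)
    (F : I -> 'rV[R]_m -> R) : open U ->
  (forall i, P i -> smooth_on U (F i)) ->
  smooth_on U (fun y => \prod_(i <- r | P i) F i y).
Proof.
move=> oU sF; elim: r => [|i r IH].
  apply: (@eq_smooth_on U (cst 1)) => //; last exact: smooth_on_cst.
  by move=> y _; rewrite big_nil.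
case Pi : (P i); last first.
  by apply: eq_smooth_on IH => // y _; rewrite big_cons Pi.
apply: (@eq_smooth_on U (fun y => F i y * \prod_(i <- r | P i) F i y)) => //.
  by move=> y _; rewrite big_cons Pi.
by apply: smooth_onM => //; exact: sF.
Qed.

Lemma smooth_on_partial U f j : smooth_on U f -> smooth_on U (partial j f).
Proof. by move=> sf k; have [_ /(_ j)[]] := sf k.+1. Qed.

Lemma smooth_on_continuous U f y : smooth_on U f -> U y -> {for y, continuous f}.
Proof. by move=> sf Uy; have [cf _] := sf 0%N; apply: cf; rewrite inE. Qed.

Lemma smooth_on_derivable U f y j : smooth_on U f -> U y ->
  derivable f y (delta_mx 0 j).
Proof. by move=> sf Uy; have [_ /(_ j)[df _]] := sf 1%N; exact: df. Qed.

Lemma smooth_on_det U n (A : 'rV[R]_m -> 'M[R]_n) : open U ->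
  (forall a b, smooth_on U (fun y => A y a b)) ->
  smooth_on U (fun y => \det (A y)).
Proof.
move=> oU sA; apply: smooth_on_sum => // s _.
apply: smooth_onM => //; first exact: smooth_on_cst.
exact: smooth_on_prod.
Qed.

(** Cramer's rule: an entry of the inverse is a cofactor, polynomial in the entries, divided by the
    nonvanishing determinant. *)
Lemma smooth_on_invmx U n (A : 'rV[R]_m -> 'M[R]_n) a b : open U ->
  (forall a b, smooth_on U (fun y => A y a b)) ->
  (forall y, U y -> A y \in unitmx) ->
  smooth_on U (fun y => invmx (A y) a b).
Proof.
move=> oU sA uA.
apply: (@eq_smooth_on U (fun y => (\det (A y))^-1 * (\adj (A y)) a b)) => //.
  by move=> y; rewrite inE => Uy; rewrite /invmx uA// !mxE.
apply: smooth_onM => //.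
  apply: smooth_onV => //; last exact: smooth_on_det.
  by move=> y Uy; rewrite -unitfE -unitmxE; exact: uA.
apply: (@eq_smooth_on U (fun y => (-1) ^+ (b + a) *
    \det (row' b (col' a (A y))))) => //.
  by move=> y _; rewrite mxE.
apply: smooth_onM => //; first exact: smooth_on_cst.
apply: smooth_on_det => // c d.
by apply: eq_smooth_on (sA (lift b c) (lift a d)) => // y _; rewrite !mxE.
Qed.

End SmoothOn.

(** * Euclidean norms and positive definite matrices *)

Section Euclid.
Context {R : realType}.

(** The index type is arbitrary so that the real and imaginary parts of a tensor form a single
    vector, indexed by [bool * 'I_m] or [bool * ('I_m * 'I_m)]. *)
Definition euclid (I : finType) (u : I -> R) : R := Num.sqrt (\sum_i u i ^+ 2).

Variable I : finType.
Implicit Types u v : I -> R.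

Lemma sumsq_ge0 u : 0 <= \sum_i u i ^+ 2.
Proof. by apply: sumr_ge0 => i _; exact: sqr_ge0. Qed.

Lemma euclid_ge0 u : 0 <= euclid u.
Proof. exact: sqrtr_ge0. Qed.

Lemma sqr_euclid u : euclid u ^+ 2 = \sum_i u i ^+ 2.
Proof. by rewrite sqr_sqrtr// sumsq_ge0. Qed.

(** Lagrange's identity: the difference of the squared sides is half the sum of the squares of all
    [u i * v j - u j * v i]. *)
Lemma euclid_dot u v : `|\sum_i u i * v i| <= euclid u * euclid v.
Proof.
rewrite -(@ler_pXn2r _ 2) ?nnegrE ?mulr_ge0 ?euclid_ge0//.
rewrite exprMn !sqr_euclid real_normK ?num_real// -subr_ge0.
set X := (X in 0 <= X).
have -> : X = 2^-1 * \sum_i \sum_j (u i * v j - u j * v i) ^+ 2.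
  pose A := \sum_i \sum_j u i ^+ 2 * v j ^+ 2.
  pose B := \sum_i \sum_j (u i * v i) * (u j * v j).
  have AE : (\sum_i u i ^+ 2) * (\sum_i v i ^+ 2) = A.
    by rewrite mulr_suml; apply: eq_bigr => i _; rewrite mulr_sumr.
  have BE : (\sum_i u i * v i) ^+ 2 = B.
    by rewrite expr2 mulr_suml; apply: eq_bigr => i _; rewrite mulr_sumr.
  have -> : \sum_i \sum_j (u i * v j - u j * v i) ^+ 2 = A + A - 2 * B.
    rewrite {2}/A [X in _ + X - _]exchange_big /= /A -big_split /= /B mulr_sumr -sumrB.
    apply: eq_bigr => i _; rewrite -big_split/= mulr_sumr -sumrB.
    by apply: eq_bigr => j _; ring.
  by rewrite /X AE BE; field.
rewrite mulr_ge0// ?invr_ge0//.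
by apply: sumr_ge0 => i _; apply: sumr_ge0 => j _; exact: sqr_ge0.
Qed.

Lemma euclidD u v : euclid (fun i => u i + v i) <= euclid u + euclid v.
Proof.
rewrite -(@ler_pXn2r _ 2) ?nnegrE ?addr_ge0 ?euclid_ge0//.
rewrite sqrrD !sqr_euclid.
have -> : \sum_i (u i + v i) ^+ 2 =
  \sum_i u i ^+ 2 + (\sum_i u i * v i) *+ 2 + \sum_i v i ^+ 2.
  by rewrite -sumrMnl -!big_split/=; apply: eq_bigr => i _; rewrite sqrrD.
rewrite lerD2r lerD2l lerMn2r/=; apply: le_trans (euclid_dot u v).
exact: ler_norm.
Qed.

Lemma euclidZ c u : euclid (fun i => c * u i) = `|c| * euclid u.
Proof.
rewrite /euclid -sqrtr_sqr -sqrtrM ?sqr_ge0// mulr_sumr.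
by congr Num.sqrt; apply: eq_bigr => i _; rewrite exprMn.
Qed.

Lemma eq_euclid u v : u =1 v -> euclid u = euclid v.
Proof. by move=> uv; congr Num.sqrt; apply: eq_bigr => i _; rewrite uv. Qed.

End Euclid.

Section PositiveDefinite.
Context {R : realType}.

Definition posdef n (H : 'M[R]_n) :=
  H^T = H /\ forall v : 'rV[R]_n, v != 0 -> 0 < (v *m H *m v^T) 0 0.

Lemma posdef_unitmx n (H : 'M[R]_n) : posdef H -> H \in unitmx.
Proof.
move=> [_ pH]; rewrite unitmxE unitfE; apply/negP => /det0P[v v0 vH].
by have := pH v v0; rewrite vH mul0mx mxE ltxx.
Qed.

Lemma posdef_invmx n (H : 'M[R]_n) : posdef H -> posdef (invmx H).
Proof.
move=> pH; have uH := posdef_unitmx pH; have [sH pos] := pH.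
have sHV : (invmx H)^T = invmx H by rewrite trmx_inv sH.
split=> // v v0; have := pos (v *m invmx H).
rewrite trmx_mul sHV mulmxKV// mulmxA; apply.
by apply: contra_neq v0 => vH; rewrite -[v](mulmxKV uH) vH mul0mx.
Qed.

(* Cholesky factorization, by induction on Schur complements. *)
Lemma posdef_factor n (H : 'M[R]_n) : posdef H ->
  exists B : 'M[R]_n, H = B *m B^T.
Proof.
elim: n H => [|n IH] H [sH pH]; first by exists 0; rewrite [LHS]flatmx0 [RHS]flatmx0.
change 'M[R]_(1 + n) in H.
change (H^T = H) in sH.
change (forall v : 'rV[R]_(1 + n), v != 0 -> 0 < (v *m H *m v^T) 0 0) in pH.
change (exists B : 'M[R]_(1 + n), H = B *m B^T).
pose a := H 0 0; pose b := ursubmx H.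
pose D := drsubmx H.
have HE : H = block_mx a%:M b b^T D.
  rewrite -{1}(submxK H) -/b /b trmx_ursub sH; congr block_mx.
  by rewrite [LHS]mx11_scalar /a !mxE; congr ((H _ _)%:M); apply: val_inj.
have sD : D^T = D by rewrite /D trmx_drsub sH.
have a0 : 0 < a.
  have := pH (row_mx 1%:M 0 : 'rV_(1 + n)); rewrite HE tr_row_mx mul_row_block.
  rewrite mul_row_col !mul1mx !mul0mx !addr0 trmx1 trmx0 mulmx0 mulmx1 addr0.
  rewrite mxE mulr1n; apply.
  by rewrite row_mx_eq0 negb_and -[1%:M]/(1 : 'M[R]_1) oner_neq0.
have [B SE] : exists B : 'M[R]_n, D - a^-1 *: (b^T *m b) = B *m B^T.
  apply: IH; split.
    by rewrite linearB/= linearZ/= trmx_mul trmxK sD.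
  (* This first coordinate makes the first block of the product with [H] vanish; what remains is the
     quadratic form of the Schur complement at [w]. *)
  move=> w w0; have := pH (row_mx ((- a^-1) *: (w *m b^T)) w : 'rV_(1 + n)).
  rewrite row_mx_eq0 negb_and w0 orbT => /(_ isT).
  rewrite HE mul_row_block tr_row_mx mul_row_col mul_mx_scalar scalerA.
  rewrite mulrN mulfV ?gt_eqF// scaleN1r addNr mul0mx add0r.
  by rewrite -scalemxAl scaleNr addrC mulmxBr -scalemxAr mulmxA.
pose s := Num.sqrt a; have s0 : s != 0 by rewrite sqrtr_eq0 -ltNge.
have ss : s * s = a by rewrite -expr2 sqr_sqrtr// ltW.
exists (block_mx s%:M 0 (s^-1 *: b^T) B); rewrite {1}HE tr_block_mx mulmx_block.
rewrite !linearZ/= trmxK tr_scalar_mx trmx0 !mulmx0 !mul0mx !addr0.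
rewrite -scalar_mxM ss mul_scalar_mx mul_mx_scalar !scalerA mulfV// mulVf// !scale1r.
by rewrite -scalemxAl scalerA -invfM ss -SE addrC subrK.
Qed.

End PositiveDefinite.

(** * Norms of covectors and 2-tensors in an orthonormal coframe *)

Section TensorNorms.
Context {R : realType} {m : nat}.
Variables (G : 'rV[R]_m -> 'M[R]_m) (y : 'rV[R]_m).
Hypothesis pG : posdef (G y).
Implicit Types (a b : 'rV[R]_m) (S T : 'M[R]_m).

Definition dot1 a b : R := \sum_i \sum_j invmx (G y) i j * a 0 i * b 0 j.
Definition tr2 T : R := \sum_i \sum_j invmx (G y) i j * T i j.

(* Components with respect to the orthonormal coframe given by the columns
   of a factor B of the inverse metric. *)
Definition pair1 (B : 'M[R]_m) a b (p : bool * 'I_m) : R :=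
  ((if p.1 then a else b) *m B) 0 p.2.
Definition pair2 (B : 'M[R]_m) S T (p : bool * ('I_m * 'I_m)) : R :=
  (B^T *m (if p.1 then S else T) *m B) p.2.1 p.2.2.

Lemma dot1E (B : 'M[R]_m) a b : invmx (G y) = B *m B^T ->
  dot1 a b = \sum_i (a *m B) 0 i * (b *m B) 0 i.
Proof.
move=> HB; transitivity ((a *m invmx (G y) *m b^T) 0 0).
  rewrite mxE /dot1 exchange_big/=; apply: eq_bigr => j _.
  rewrite !mxE mulr_suml; apply: eq_bigr => i _.
  by rewrite [X in X * _]mulrC.
rewrite HB mulmxA -mulmxA -trmx_mul mxE.
by apply: eq_bigr => i _; rewrite [X in _ * X]mxE.
Qed.

Lemma sqnorm1E (B : 'M[R]_m) a : invmx (G y) = B *m B^T ->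
  sqnorm1 G y a = \sum_i (a *m B) 0 i ^+ 2.
Proof. by move=> HB; rewrite -[LHS]/(dot1 a a) (dot1E _ _ HB). Qed.

Lemma tr2E (B : 'M[R]_m) T : invmx (G y) = B *m B^T ->
  tr2 T = \sum_i (B^T *m T *m B) i i.
Proof.
move=> HB; transitivity (\tr (invmx (G y) *m T^T)).
  rewrite /mxtrace; apply: eq_bigr => i _; rewrite mxE; apply: eq_bigr => j _.
  by rewrite [T^T _ _]mxE.
rewrite HB -mxtrace_tr !trmx_mul !trmxK mxtrace_mulC -mulmxA.
by rewrite mxtrace_mulC.
Qed.

(** With [H] the inverse metric, the index sum is the trace of [T^T *m H *m T *m H]; cyclicity of
    the trace splits it into the Frobenius norm of [B^T *m T *m B]. *)
Lemma sqnorm2E (B : 'M[R]_m) T : invmx (G y) = B *m B^T ->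
  sqnorm2 G y T = \sum_p (B^T *m T *m B) p.1 p.2 ^+ 2.
Proof.
move=> HB; have sH := (posdef_invmx pG).1.
set H := invmx (G y) in HB sH *.
have sHe i j : H i j = H j i by rewrite -[in LHS]sH mxE.
transitivity (\tr (T^T *m (H *m T *m H))).
  rewrite /mxtrace /sqnorm2 exchange_big/=; apply: eq_bigr => j _.
  rewrite mxE; apply: eq_bigr => i _.
  rewrite [T^T _ _]mxE mxE mulr_sumr exchange_big/=; apply: eq_bigr => l _.
  rewrite mxE mulr_suml mulr_sumr; apply: eq_bigr => k _.
  rewrite -/H (sHe j l).
  by move: (H i k) (H l j) (T i j) (T k l) => ? ? ? ?; ring.
rewrite HB; transitivity (\tr ((B^T *m T *m B)^T *m (B^T *m T *m B))).
  rewrite !trmx_mul trmxK -(mulmxA B^T) -(mulmxA B^T).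
  by rewrite [RHS]mxtrace_mulC !mulmxA.
rewrite /mxtrace (eq_bigr (fun j => \sum_i (B^T *m T *m B) i j ^+ 2)).
  by rewrite exchange_big pair_big.
by move=> j _; rewrite mxE; apply: eq_bigr => i _; rewrite [X in X * _]mxE.
Qed.

Lemma sqrt_sqnorm1E (B : 'M[R]_m) a b : invmx (G y) = B *m B^T ->
  Num.sqrt (sqnorm1 G y a + sqnorm1 G y b) = euclid (pair1 B a b).
Proof.
move=> HB; rewrite !(sqnorm1E _ HB) /euclid.
rewrite -(pair_bigA _ (fun c i => pair1 B a b (c, i) ^+ 2))/=.
by rewrite big_bool.
Qed.

Lemma sqrt_sqnorm2E (B : 'M[R]_m) S T : invmx (G y) = B *m B^T ->
  Num.sqrt (sqnorm2 G y S + sqnorm2 G y T) = euclid (pair2 B S T).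
Proof.
move=> HB; rewrite !(sqnorm2E _ HB) /euclid.
rewrite -(pair_bigA _ (fun c i => pair2 B S T (c, i) ^+ 2))/=.
by rewrite big_bool.
Qed.

Lemma norm1_triangle a b a' b' :
  Num.sqrt (sqnorm1 G y (a + a') + sqnorm1 G y (b + b')) <=
  Num.sqrt (sqnorm1 G y a + sqnorm1 G y b) +
  Num.sqrt (sqnorm1 G y a' + sqnorm1 G y b').
Proof.
have [B HB] := posdef_factor (posdef_invmx pG).
rewrite !(sqrt_sqnorm1E _ _ HB); apply: le_trans (euclidD _ _).
by rewrite le_eqVlt; apply/orP; left; apply/eqP/eq_euclid => -[[] i];
  rewrite /pair1/= mulmxDl mxE.
Qed.

Lemma norm1Z c a b :
  Num.sqrt (sqnorm1 G y (c *: a) + sqnorm1 G y (c *: b)) =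
  `|c| * Num.sqrt (sqnorm1 G y a + sqnorm1 G y b).
Proof.
have [B HB] := posdef_factor (posdef_invmx pG).
rewrite !(sqrt_sqnorm1E _ _ HB) -euclidZ; apply: eq_euclid => -[[] i];
  by rewrite /pair1/= -scalemxAl mxE.
Qed.

Lemma sqnorm1Z c a : sqnorm1 G y (c *: a) = c ^+ 2 * sqnorm1 G y a.
Proof.
rewrite /sqnorm1 mulr_sumr; apply: eq_bigr => i _; rewrite mulr_sumr.
by apply: eq_bigr => j _; rewrite !mxE; ring.
Qed.

Lemma sqnorm1_ge0 a : 0 <= sqnorm1 G y a.
Proof.
have [B HB] := posdef_factor (posdef_invmx pG).
by rewrite (sqnorm1E _ HB) sumsq_ge0.
Qed.

(** Serves for the term [h d chi] of the Leibniz rule: [a] is [d chi], and [c], [c'] are the real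
    and imaginary parts of [h]. *)
Lemma norm1_scalars c c' a :
  Num.sqrt (sqnorm1 G y (c *: a) + sqnorm1 G y (c' *: a)) =
  Num.sqrt (c ^+ 2 + c' ^+ 2) * Num.sqrt (sqnorm1 G y a).
Proof. by rewrite !sqnorm1Z -mulrDl sqrtrM// addr_ge0 ?sqr_ge0. Qed.

Lemma dot1C a b : dot1 a b = dot1 b a.
Proof.
have [B HB] := posdef_factor (posdef_invmx pG).
by rewrite !(dot1E _ _ HB); apply: eq_bigr => i _; rewrite mulrC.
Qed.

(** Cauchy-Schwarz for each of [b] and [c], then addition of the squares. Here [a] will be the
    differential of a real cut-off, [b] and [c] those of the two parts of a complex function. *)
Lemma norm_dot1_le a b c :
  Num.sqrt (dot1 a b ^+ 2 + dot1 a c ^+ 2) <=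
  Num.sqrt (sqnorm1 G y a) * Num.sqrt (sqnorm1 G y b + sqnorm1 G y c).
Proof.
have CS d : dot1 a d ^+ 2 <= sqnorm1 G y a * sqnorm1 G y d.
  have [B HB] := posdef_factor (posdef_invmx pG).
  rewrite !(sqnorm1E _ HB) (dot1E _ _ HB) -!sqr_euclid -exprMn.
  rewrite -real_normK ?num_real// ler_pXn2r ?nnegrE ?mulr_ge0 ?euclid_ge0//.
  exact: euclid_dot.
by rewrite -sqrtrM ?sqnorm1_ge0// ler_wsqrtr// mulrDr lerD.
Qed.

Lemma norm2_triangle S T S' T' :
  Num.sqrt (sqnorm2 G y (S + S') + sqnorm2 G y (T + T')) <=
  Num.sqrt (sqnorm2 G y S + sqnorm2 G y T) +
  Num.sqrt (sqnorm2 G y S' + sqnorm2 G y T').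
Proof.
have [B HB] := posdef_factor (posdef_invmx pG).
rewrite !(sqrt_sqnorm2E _ _ HB); apply: le_trans (euclidD _ _).
by rewrite le_eqVlt; apply/orP; left; apply/eqP/eq_euclid => -[[] i];
  rewrite /pair2/= mulmxDr mulmxDl mxE.
Qed.

(** The trace is the dot product of the diagonal with the all-ones vector, whose length is the
    factor [Num.sqrt m%:R]; the diagonal is then bounded by the full set of entries. *)
Lemma norm_tr2_le S T :
  Num.sqrt (tr2 S ^+ 2 + tr2 T ^+ 2) <=
  Num.sqrt m%:R * Num.sqrt (sqnorm2 G y S + sqnorm2 G y T).
Proof.
have CS W : tr2 W ^+ 2 <= m%:R * sqnorm2 G y W.
  have [B HB] := posdef_factor (posdef_invmx pG).
  rewrite (sqnorm2E _ HB) (tr2E _ HB); set V := B^T *m W *m B.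
  have := @euclid_dot R 'I_m (fun=> 1) (fun i => V i i).
  under eq_bigr do rewrite mul1r.
  rewrite -(@ler_pXn2r _ 2) ?nnegrE ?mulr_ge0 ?euclid_ge0//.
  rewrite real_normK ?num_real// exprMn !sqr_euclid expr1n sumr_const card_ord.
  move=> /le_trans; apply; rewrite ler_wpM2l//.
  rewrite -(pair_bigA _ (fun i j => V i j ^+ 2))/=; apply: ler_sum => i _.
  by rewrite (bigD1 i)//= lerDl sumr_ge0// => j _; exact: sqr_ge0.
by rewrite -sqrtrM// ler_wsqrtr// mulrDr lerD.
Qed.

End TensorNorms.

(** * Leibniz rules and the Laplacian in a chart *)

Section Local.
Context {R : realType} {m : nat}.
Variables (U : set 'rV[R]_m) (G : 'rV[R]_m -> 'M[R]_m).
Hypothesis oU : open U.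
Hypothesis sG : forall a b, smooth_on U (fun y => G y a b).
Hypothesis pG : forall y, U y -> posdef (G y).
Implicit Types (f h : 'rV[R]_m -> R) (y : 'rV[R]_m) (j : 'I_m).

Let smooth_inv a b : smooth_on U (fun y => invmx (G y) a b).
Proof. by apply: smooth_on_invmx => // y Uy; apply: posdef_unitmx; exact: pG. Qed.

Lemma partial_sum (I : Type) (r : seq I) (F : I -> 'rV[R]_m -> R) j y :
  (forall i, smooth_on U (F i)) -> U y ->
  partial j (fun z => \sum_(i <- r) F i z) y = \sum_(i <- r) partial j (F i) y.
Proof.
move=> sF Uy; elim: r => [|i r IH].
  rewrite big_nil (_ : (fun z => _) = cst 0) ?/partial ?derive_cst//.
  by apply/funext => z; rewrite big_nil.
rewrite big_cons -IH -partialD.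
- by congr (partial j _ y); apply/funext => z; rewrite big_cons.
- exact: smooth_on_derivable (sF i) Uy.
- by apply: smooth_on_derivable Uy; exact: smooth_on_sum.
Qed.

Lemma differentialD f h y : smooth_on U f -> smooth_on U h -> U y ->
  differential (fun z => f z + h z) y = differential f y + differential h y.
Proof.
move=> sf sh Uy; apply/rowP => j; rewrite !mxE partialD//;
  exact: smooth_on_derivable Uy.
Qed.

Lemma differentialN f y : smooth_on U f -> U y ->
  differential (fun z => - f z) y = - differential f y.
Proof.
move=> sf Uy; apply/rowP => j; rewrite !mxE partialN//.
exact: smooth_on_derivable Uy.
Qed.

Lemma differentialM f h y : smooth_on U f -> smooth_on U h -> U y ->
  differential (fun z => f z * h z) y =
  f y *: differential h y + h y *: differential f y.
Proof.
move=> sf sh Uy; apply/rowP => j; rewrite !mxE partialM//;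
  exact: smooth_on_derivable Uy.
Qed.

Lemma hessianD f h y : smooth_on U f -> smooth_on U h -> U y ->
  hessian G (fun z => f z + h z) y = hessian G f y + hessian G h y.
Proof.
move=> sf sh Uy; apply/matrixP => i j; rewrite !mxE.
have E k z : U z -> partial k (fun z => f z + h z) z = partial k f z + partial k h z.
  by move=> Uz; rewrite partialD//; exact: smooth_on_derivable Uz.
(* The first-order formula is known on [U] only, so it is substituted under the outer derivative by
   locality. *)
rewrite (@eq_partial _ _ U _ (fun z => partial j f z + partial j h z))//; last first.
  by move=> z; rewrite inE => /E.
rewrite partialD; try by apply: smooth_on_derivable Uy; exact: smooth_on_partial.
under eq_bigr do rewrite E// mulrDr.
by rewrite big_split/= opprD addrACA.
Qed.

Lemma hessianN f y : smooth_on U f -> U y ->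
  hessian G (fun z => - f z) y = - hessian G f y.
Proof.
move=> sf Uy; apply/matrixP => i j; rewrite !mxE.
have E k z : U z -> partial k (fun z => - f z) z = - partial k f z.
  by move=> Uz; rewrite partialN//; exact: smooth_on_derivable Uz.
rewrite (@eq_partial _ _ U _ (fun z => - partial j f z))//; last first.
  by move=> z; rewrite inE => /E.
rewrite partialN; last by apply: smooth_on_derivable Uy; exact: smooth_on_partial.
under eq_bigr do rewrite E// mulrN.
by rewrite sumrN opprD.
Qed.

Lemma eq_hessian (V : set 'rV[R]_m) f h y : open V -> V y -> {in V, f =1 h} ->
  hessian G f y = hessian G h y.
Proof.
move=> oV Vy fh; apply/matrixP => i j; rewrite !mxE.
have E k : {in V, partial k f =1 partial k h}.
  by move=> z; rewrite inE => Vz; exact: eq_partial oV Vz fh.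
rewrite (eq_partial _ oV Vy (E j)); congr (_ - _).
by apply: eq_bigr => k _; rewrite (eq_partial _ oV Vy fh).
Qed.

Lemma smooth_on_christoffel k i j : smooth_on U (christoffel G k i j).
Proof.
apply: smooth_onM => //; first exact: smooth_on_cst.
apply: smooth_on_sum => // l _; apply: smooth_onM => //.
by apply: smooth_onB => //; first apply: smooth_onD => //; exact: smooth_on_partial.
Qed.

Lemma smooth_on_gradient f i : smooth_on U f ->
  smooth_on U (fun z => gradient G f z 0 i).
Proof.
move=> sf; apply: (@eq_smooth_on _ _ U
    (fun z => \sum_j invmx (G z) i j * partial j f z)) => //.
  by move=> z _; rewrite mxE.
apply: smooth_on_sum => // j _; apply: smooth_onM => //; exact: smooth_on_partial.
Qed.

Lemma smooth_on_laplacian f : smooth_on U f -> smooth_on U (laplacian G f).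
Proof.
move=> sf; apply: smooth_on_sum => // i _; apply: smooth_onD => //.
  by apply: smooth_on_partial; exact: smooth_on_gradient.
apply: smooth_on_sum => // j _; apply: smooth_onM => //.
  exact: smooth_on_christoffel.
exact: smooth_on_gradient.
Qed.

Lemma smooth_on_sqnorm_differential f : smooth_on U f ->
  smooth_on U (fun z => sqnorm1 G z (differential f z)).
Proof.
move=> sf; have sd i : smooth_on U (fun z => differential f z 0 i).
  apply: (@eq_smooth_on _ _ U (partial i f)) => //; last exact: smooth_on_partial.
  by move=> z _; rewrite mxE.
apply: smooth_on_sum => // i _; apply: smooth_on_sum => // j _.
by do 2! apply: smooth_onM => //.
Qed.

Lemma smooth_on_sqnorm_hessian f : smooth_on U f ->
  smooth_on U (fun z => sqnorm2 G z (hessian G f z)).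
Proof.
move=> sf; have sh i j : smooth_on U (fun z => hessian G f z i j).
  apply: (@eq_smooth_on _ _ U (fun z => partial i (partial j f) z -
      \sum_k christoffel G k i j z * partial k f z)) => //.
    by move=> z _; rewrite mxE.
  apply: smooth_onB => //; first by do 2! apply: smooth_on_partial.
  apply: smooth_on_sum => // k _; apply: smooth_onM => //.
    exact: smooth_on_christoffel.
  exact: smooth_on_partial.
do 4! [apply: smooth_on_sum => // ? _].
by do 3! apply: smooth_onM => //.
Qed.

Lemma laplacianM f h y : smooth_on U f -> smooth_on U h -> U y ->
  laplacian G (fun z => f z * h z) y =
  f y * laplacian G h y + h y * laplacian G f y +
  2 * dot1 G y (differential f y) (differential h y).
Proof.
move=> sf sh Uy.
have gradM z i : U z -> gradient G (fun z => f z * h z) z 0 i =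
    f z * gradient G h z 0 i + h z * gradient G f z 0 i.
  move=> Uz; rewrite !mxE !mulr_sumr -big_split/=; apply: eq_bigr => j _.
  rewrite partialM; try exact: smooth_on_derivable Uz.
  ring.
have dotE a b : \sum_i partial i a y * gradient G b y 0 i =
    dot1 G y (differential a y) (differential b y).
  apply: eq_bigr => i _; rewrite mxE mulr_sumr; apply: eq_bigr => j _.
  by rewrite !mxE; ring.
(* Written as the sum of both orders of the scalar product, the mixed term takes the shape of
   [dotE], and the identity then holds summand by summand. *)
rewrite mulr2n mulrDl mul1r {2}(dot1C (pG Uy)) -!dotE /laplacian /divergence.
rewrite !mulr_sumr -!big_split/=; apply: eq_bigr => i _.
rewrite (@eq_partial _ _ U _
  (fun z => f z * gradient G h z 0 i + h z * gradient G f z 0 i))//; last first.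
  by move=> z; rewrite inE => /gradM.
have sg a : smooth_on U a -> derivable (fun z => gradient G a z 0 i) y (delta_mx 0 i).
  by move=> sa; apply: smooth_on_derivable Uy; exact: smooth_on_gradient.
have df a : smooth_on U a -> derivable a y (delta_mx 0 i).
  by move=> sa; exact: smooth_on_derivable Uy.
rewrite partialD; [|exact: derivableM (df _ sf) (sg _ sh)|
  exact: derivableM (df _ sh) (sg _ sf)].
rewrite (partialM (df _ sf) (sg _ sh)) (partialM (df _ sh) (sg _ sf)).
under eq_bigr do rewrite gradM// mulrDr !(mulrCA (christoffel _ _ _ _ _)).
rewrite big_split/= -!mulr_sumr.
move: (partial i (fun z => gradient G h z 0 i) y) (\sum_j _ * gradient G h y 0 j).
move: (partial i (fun z => gradient G f z 0 i) y) (\sum_j _ * gradient G f y 0 j).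
move: (gradient G h y 0 i) (gradient G f y 0 i) (partial i f y) (partial i h y).
by move: (f y) (h y) => *; ring.
Qed.

(* The connection is metric; in coordinates this is the identity first_order,
   obtained from d(G^-1) = - G^-1 dG G^-1. *)
Lemma laplacian_hessian f y : smooth_on U f -> U y ->
  laplacian G f y = tr2 G y (hessian G f y).
Proof.
move=> sf Uy; pose H i j := invmx (G y) i j.
pose P a b c := partial a (fun z => G z b c) y.
have HC i j : H i j = H j i.
  by rewrite /H -[in LHS](posdef_invmx (pG Uy)).1 mxE.
have PC a b c : P a b c = P a c b.
  apply: (@eq_partial _ _ U) => // z; rewrite inE => Uz.
  by rewrite -[in LHS](pG Uz).1 mxE.
(* [A] is the metric contraction of the derivative index with an index of the metric; [B c] is the
   derivative of [log (det G)] in direction [c]. All contractions of Christoffel symbols below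
   reduce to these two. *)
pose A c := \sum_i \sum_b H i b * P i b c.
pose B c := \sum_i \sum_b H i b * P c i b.
have dH i a b : partial i (fun z => invmx (G z) a b) y =
    - \sum_c \sum_d H a c * P i c d * H d b.
  pose dHm := \matrix_(a, b) partial i (fun z => invmx (G z) a b) y.
  pose dGm := \matrix_(c, d) P i c d.
  have uG := posdef_unitmx (pG Uy).
  (* The derivative of the constant product of the inverse metric with the metric; multiplying by
     the inverse on the right isolates [dHm]. *)
  have : dHm *m G y + invmx (G y) *m dGm = 0.
    apply/matrixP => c d; rewrite !mxE -big_split/=.
    transitivity (partial i (fun z => \sum_e invmx (G z) c e * G z e d) y).
      rewrite partial_sum//; last by move=> e; exact: smooth_onM.
      apply: eq_bigr => e _; rewrite !mxE partialM; first by rewrite /P; ring.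
        exact: smooth_on_derivable Uy.
      exact: smooth_on_derivable Uy.
    rewrite (@eq_partial _ _ U _ (cst ((1%:M : 'M[R]_m) c d)))//.
      exact: derive_cst.
    move=> z; rewrite inE => Uz; rewrite /= -(mulVmx (posdef_unitmx (pG Uz))).
    by rewrite mxE.
  move/eqP; rewrite addr_eq0 => /eqP /(congr1 (mulmx^~ (invmx (G y)))).
  rewrite mulmxK// => /matrixP /(_ a b); rewrite !mxE => ->.
  rewrite exchange_big/= -sumrN; apply: eq_bigr => d _.
  rewrite !mxE mulNr mulr_suml; congr (- _).
  by apply: eq_bigr => c _; rewrite mxE.
have divH k : \sum_i partial i (fun z => invmx (G z) i k) y =
    - \sum_c H k c * A c.
  under eq_bigr do rewrite dH.
  rewrite sumrN; congr (- _).
  under eq_bigr do rewrite exchange_big/=.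
  rewrite exchange_big/=; apply: eq_bigr => c _.
  rewrite /A mulr_sumr; apply: eq_bigr => i _.
  rewrite mulr_sumr; apply: eq_bigr => b _.
  by rewrite (HC c k) mulrC.
(* The classical formula for the contracted symbol as the derivative of [log (sqrt (det G))]: the
   other two terms cancel by symmetry. *)
have trG j : \sum_i christoffel G i i j y = 2^-1 * B j.
  rewrite /christoffel -mulr_sumr; congr (_ * _).
  transitivity (\sum_i \sum_l H i l * P i j l + B j - \sum_i \sum_l H i l * P l i j).
    rewrite /B -big_split -sumrB/=; apply: eq_bigr => i _.
    rewrite -big_split -sumrB/=; apply: eq_bigr => l _.
    by rewrite -/(H i l) -!/(P _ _ _); ring.
  rewrite [X in _ - X]exchange_big/=.
  rewrite addrAC (_ : _ - _ = 0) ?add0r//; apply/eqP; rewrite subr_eq0.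
  by apply/eqP; apply: eq_bigr => i _; apply: eq_bigr => l _; rewrite HC PC.
have HG k : \sum_i \sum_j H i j * christoffel G k i j y =
    \sum_c H k c * (A c - 2^-1 * B c).
  transitivity (\sum_i \sum_j \sum_c H k c *
      (2^-1 * (H i j * P i j c + H i j * P j i c - H i j * P c i j))).
    apply: eq_bigr => i _; apply: eq_bigr => j _.
    rewrite /christoffel !mulr_sumr; apply: eq_bigr => c _.
    by rewrite -/(H k c) -!/(P _ _ _); ring.
  under eq_bigr do rewrite exchange_big/=.
  rewrite exchange_big/=; apply: eq_bigr => c _.
  under eq_bigr do rewrite -mulr_sumr.
  rewrite -mulr_sumr; congr (_ * _).
  under eq_bigr do rewrite -mulr_sumr.
  rewrite -mulr_sumr.
  (* The first two terms of the Christoffel symbol contribute half of [A c] each, the second one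
     after exchanging [i] and [j]. *)
  have A2 : A c = \sum_i \sum_j H i j * P j i c.
    rewrite /A exchange_big/=; apply: eq_bigr => i _; apply: eq_bigr => j _.
    by rewrite (HC j i).
  have AA : A c = 2^-1 * (A c + A c) by move: (A c) => a; field.
  rewrite AA -mulrBr; congr (_ * _); rewrite [X in _ = _ + X - _]A2.
  rewrite -big_split -sumrB/=; apply: eq_bigr => i _.
  by rewrite -big_split -sumrB/=; apply: eq_bigr.
have first_order k : \sum_i partial i (fun z => invmx (G z) i k) y +
    \sum_i \sum_j christoffel G i i j y * H j k =
    - \sum_i \sum_j H i j * christoffel G k i j y.
  rewrite divH HG exchange_big/=.
  under [X in _ + X]eq_bigr do rewrite -mulr_suml trG.
  rewrite -!sumrN -big_split/=; apply: eq_bigr => c _.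
  by rewrite (HC k c); ring.
have sd k : smooth_on U (partial k f) by exact: smooth_on_partial.
(* The divergence of the gradient is expanded into its principal part and first-order terms;
   [first_order] then identifies the coefficient of each [partial k f] with the one in the trace of
   the Hessian. *)
have -> : laplacian G f y = \sum_i \sum_j H i j * partial i (partial j f) y +
    \sum_k (\sum_i partial i (fun z => invmx (G z) i k) y +
      \sum_i \sum_j christoffel G i i j y * H j k) * partial k f y.
  under [X in _ + X]eq_bigr do rewrite mulrDl mulr_suml.
  rewrite big_split/= [X in _ + (X + _)]exchange_big/= addrA -big_split/=.
  under [X in _ + X]eq_bigr do rewrite mulr_suml.
  rewrite [X in _ + X]exchange_big -big_split/=; apply: eq_bigr => i _.
  congr (_ + _).
    rewrite -big_split/=.
    rewrite (@eq_partial _ _ U _ (fun z => \sum_j invmx (G z) i j * partial j f z))//.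
      rewrite partial_sum//; last by move=> j; exact: smooth_onM.
      apply: eq_bigr => j _; rewrite partialM.
      - by congr (_ + _); exact: mulrC.
      - exact: smooth_on_derivable Uy.
      - exact: smooth_on_derivable Uy.
    by move=> z _; rewrite mxE.
  under [RHS]eq_bigr do rewrite mulr_suml.
  rewrite exchange_big/=; apply: eq_bigr => j _.
  rewrite mxE mulr_sumr; apply: eq_bigr => k _.
  by rewrite mulrA.
under [X in _ + X]eq_bigr do rewrite first_order mulNr mulr_suml.
rewrite sumrN [X in _ - X]exchange_big/= -sumrB; apply: eq_bigr => i _.
under [X in _ - X]eq_bigr do rewrite mulr_suml.
rewrite [X in _ - X]exchange_big/= -sumrB; apply: eq_bigr => j _.
rewrite mxE mulrBr mulr_sumr; congr (_ - _).
by apply: eq_bigr => k _; exact/esym/mulrA.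
Qed.

End Local.

(** * L^q norms *)

Section LqNorm.
Context d (T : measurableType d) (R : realType).
Variables (mu : {measure set T -> \bar R}) (q : R).
Hypothesis q1 : 1 < q.
Implicit Types F H : T -> R.
Local Open Scope ereal_scope.

Local Notation N F := ('N[mu]_(q%:E)[EFin \o F]).

Let q0 : (0 < q)%R. Proof. exact: lt_trans q1. Qed.

Let measurable_powR_norm F : measurable_fun [set: T] F ->
  measurable_fun [set: T] (fun x => (`|F x| `^ q)%:E).
Proof.
move=> mF; apply/measurable_EFinP.
apply: (measurableT_comp (measurable_powR _)).
exact: measurableT_comp.
Qed.

Let int_ge0 F : 0 <= \int[mu]_x (`|F x| `^ q)%:E.
Proof. by apply: integral_ge0 => x _; rewrite lee_fin powR_ge0. Qed.

Lemma LnormE F : N F = (\int[mu]_x (`|F x| `^ q)%:E) `^ q^-1.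
Proof. by rewrite unlock. Qed.

Lemma Lnorm_powE F : \int[mu]_x (`|F x| `^ q)%:E = N F `^ q.
Proof.
by rewrite poweR_Lnorm ?gt_eqF.
Qed.

Lemma Lnorm_mono F H : measurable_fun [set: T] F -> measurable_fun [set: T] H ->
  (forall x, (`|F x| <= H x)%R) -> N F <= N H.
Proof.
move=> mF mH FH; rewrite !LnormE; apply: gt0_ler_poweR.
- by rewrite invr_ge0 ltW.
- by rewrite in_itv/= leey andbT int_ge0.
- by rewrite in_itv/= leey andbT int_ge0.
apply: ge0_le_integral => //; try exact: measurable_powR_norm.
- move=> x _; rewrite lee_fin ge0_ler_powR ?nnegrE//; first exact: ltW.
  exact: le_trans (FH x) (ler_norm _).
Qed.

Lemma Lnorm_scale F (c : R) : measurable_fun [set: T] F -> (0 <= c)%R ->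
  N (fun x => c * F x)%R = c%:E * N F.
Proof.
move=> mF c0; rewrite !LnormE.
under eq_integral do rewrite normrM powRM// EFinM.
rewrite ge0_integralZl//; last exact: measurable_powR_norm.
rewrite poweRM ?int_ge0 ?lee_fin ?powR_ge0//.
rewrite poweR_EFin -powRrM mulfV ?gt_eqF// powRr1 ?normr_ge0//.
by rewrite ger0_norm.
Qed.

(** Fatou's lemma for the q-th powers. Pointwise convergence is asked in the form of eventual
    equality, which is what cut-offs provide. *)
Lemma Lnorm_le_fatou (F_ : nat -> T -> R) F (e : R) : (0 <= e)%R ->
  (forall k, measurable_fun [set: T] (F_ k)) ->
  (forall x, \forall k \near \oo, F_ k x = F x) ->
  (\forall k \near \oo, N (F_ k) <= e%:E) -> N F <= e%:E.
Proof.
move=> e0 mF FF Fe.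
rewrite LnormE.
have -> : e%:E = (e%:E `^ q) `^ q^-1.
  by rewrite -poweRrM mulfV ?gt_eqF// poweRe1.
apply: gt0_ler_poweR.
- by rewrite invr_ge0 ltW.
- by rewrite in_itv/= leey andbT int_ge0.
- by rewrite in_itv/= leey andbT lee_fin powR_ge0.
pose u k x := (`|F_ k x| `^ q)%:E.
have -> : \int[mu]_x (`|F x| `^ q)%:E = \int[mu]_x limn_einf (u ^~ x).
  apply: eq_integral => x _.
  suff ux : u ^~ x @ \oo --> (`|F x| `^ q)%:E.
    rewrite is_cvg_limn_einfE; last by apply/cvg_ex; eexists; exact: ux.
    by apply/esym/cvg_lim.
  apply: cvg_near_cst.
  by apply: filterS (FF x) => k; rewrite /u => ->.
apply: le_trans (fatou mu measurableT _ _) _.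
- by move=> k; exact: measurable_powR_norm.
- by move=> k x _; rewrite lee_fin powR_ge0.
rewrite limn_einf_lim; apply: lime_le; first exact: is_cvg_einfs.
apply: nearW => n; have [k _ ke] := Fe.
(* The index [maxn n k] belongs to the tail after [n], over which the infimum is taken, and lies
   beyond the threshold [k] of the norm bound. *)
apply: (@le_trans _ _ (\int[mu]_x u (maxn n k) x)).
  by apply: ereal_inf_lbound; exists (maxn n k) => //=; exact: leq_maxl.
rewrite /u Lnorm_powE; apply: gt0_ler_poweR.
- exact: ltW.
- by rewrite in_itv/= leey andbT Lnorm_ge0.
- by rewrite in_itv/= leey andbT lee_fin.
by apply: ke; exact: leq_maxr.
Qed.

Lemma Lnorm_dominated (eta : nat -> T -> R) F :
  (forall n, measurable_fun [set: T] (eta n)) -> measurable_fun [set: T] F ->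
  N F < +oo -> (forall n x, `|eta n x| <= 1)%R ->
  (forall x, \forall n \near \oo, eta n x = 0%R) ->
  forall e : R, (0 < e)%R -> \forall n \near \oo, N (fun x => eta n x * F x)%R <= e%:E.
Proof.
move=> meta mF Foo eta1 eta0 e e0.
pose u n x := (`|eta n x * F x| `^ q)%:E.
have mu_ n : measurable_fun [set: T] (u n).
  by apply: measurable_powR_norm; exact: measurable_funM.
have [||||_ _] := @dominated_convergence _ _ _ mu _ measurableT u (cst 0)
    (fun x => (`|F x| `^ q)%:E) mu_.
- exact: measurable_cst.
- apply/aeW => x _; apply: cvg_near_cst.
  by apply: filterS (eta0 x) => n; rewrite /u => ->; rewrite mul0r normr0 powR0 ?gt_eqF.
- apply/integrableP; split; first exact: measurable_powR_norm.
  under eq_integral do rewrite gee0_abs ?lee_fin ?powR_ge0//.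
  by rewrite Lnorm_powE poweR_lty.
- apply/aeW => x n _; rewrite gee0_abs ?lee_fin ?powR_ge0//.
  by rewrite ge0_ler_powR ?nnegrE//; [exact: ltW|rewrite normrM ler_piMl].
rewrite integral0 => /fine_cvgP[ufin]; move=> /cvgrPdist_le /(_ (e `^ q)%R).
rewrite powR_gt0// => /(_ isT); move: ufin; apply: filterS2 => n ufin /=.
rewrite sub0r normrN => une.
rewrite LnormE.
have -> : e%:E = (e%:E `^ q) `^ q^-1.
  by rewrite -poweRrM mulfV ?gt_eqF// poweRe1// lee_fin ltW.
have u0 : 0 <= \int[mu]_x u n x.
  exact: int_ge0.
apply: gt0_ler_poweR.
- by rewrite invr_ge0 ltW.
- by rewrite in_itv/= leey andbT.
- by rewrite in_itv/= leey andbT lee_fin powR_ge0.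
rewrite -[leLHS](fineK (ufin : \int[mu]_x u n x \is a fin_num)).
rewrite poweR_EFin lee_fin; apply: le_trans une.
exact: ler_norm.
Qed.

End LqNorm.

(** * Pointwise estimates on the manifold *)

Lemma sqrt_sqrD_triangle (R : realType) (a b c d : R) :
  Num.sqrt ((a + c) ^+ 2 + (b + d) ^+ 2) <=
  Num.sqrt (a ^+ 2 + b ^+ 2) + Num.sqrt (c ^+ 2 + d ^+ 2).
Proof.
have E x y : Num.sqrt (x ^+ 2 + y ^+ 2) = euclid (fun e : bool => if e then x else y).
  by rewrite /euclid big_bool.
rewrite !E; apply: le_trans (euclidD _ _).
by rewrite le_eqVlt; apply/orP; left; apply/eqP/eq_euclid => -[].
Qed.

Lemma sqrt_sqrZ (R : realType) (k a b : R) :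
  Num.sqrt ((k * a) ^+ 2 + (k * b) ^+ 2) = `|k| * Num.sqrt (a ^+ 2 + b ^+ 2).
Proof. by rewrite -sqrtr_sqr -sqrtrM ?sqr_ge0// mulrDr !exprMn. Qed.

Section Manifold.
Context {R : realType} {m : nat} {M : topologicalType} (g : riemannian R m M).
Implicit Types (f chi : M -> R) (h k : M -> R[i]) (x : M).

Local Notation dom x := (cdom (atlas g (chart_at g x))).
Local Notation img x := (cimg (atlas g (chart_at g x))).

Lemma chart_atP x : dom x x.
Proof. by rewrite /chart_at; case: ex_minnP => n /asboolP. Qed.

Lemma coord_cimg x : img x (coord g x).
Proof. by exists x => //; exact: chart_atP. Qed.

Lemma coordK x : cinv (atlas g (chart_at g x)) (coord g x) = x.
Proof. by apply: cmapK; rewrite inE; exact: chart_atP. Qed.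

Lemma posdef_metric i y : cimg (atlas g i) y -> posdef (metric g i y).
Proof.
by move=> iy; split=> [|v v0]; [exact: Defs.metric_sym|exact: Defs.metric_pos].
Qed.

Let oimg x : open (img x). Proof. exact: cimg_open. Qed.
Let sG x a b : smooth_on (img x) (fun y => metric_at g x y a b).
Proof. exact: metric_smooth. Qed.
Let pG x y : img x y -> posdef (metric_at g x y).
Proof. exact: posdef_metric. Qed.
Let pGx x : posdef (metric_at g x (coord g x)).
Proof. exact/pG/coord_cimg. Qed.

Lemma smoothD f1 f2 : smooth g f1 -> smooth g f2 -> smooth g (fun x => f1 x + f2 x).
Proof. by move=> s1 s2 i; exact: (smooth_onD (@cimg_open _ _ _ _) (s1 i) (s2 i)). Qed.

Lemma smoothN f : smooth g f -> smooth g (fun x => - f x).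
Proof. by move=> s1 i; exact: (smooth_onN (@cimg_open _ _ _ _) (s1 i)). Qed.

Lemma smoothB f1 f2 : smooth g f1 -> smooth g f2 -> smooth g (fun x => f1 x - f2 x).
Proof. by move=> s1 s2; apply: smoothD => //; exact: smoothN. Qed.

Lemma smoothM f1 f2 : smooth g f1 -> smooth g f2 -> smooth g (fun x => f1 x * f2 x).
Proof. by move=> s1 s2 i; exact: (smooth_onM (@cimg_open _ _ _ _) (s1 i) (s2 i)). Qed.

Lemma smooth_cst (c : R) : smooth g (cst c).
Proof. by move=> i; exact: smooth_on_cst. Qed.

Lemma norm_dD f1 f2 x : smooth g f1 -> smooth g f2 ->
  norm_d g (fun x => f1 x + f2 x) x <= norm_d g f1 x + norm_d g f2 x.
Proof.
move=> s1 s2; rewrite /norm_d /sqnorm_d.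
rewrite (differentialD (s1 _) (s2 _) (coord_cimg x)).
(* The complex triangle inequality, with both imaginary parts zero. *)
have := norm1_triangle (pGx x) (differential (local g f1 x) (coord g x)) 0
  (differential (local g f2 x) (coord g x)) 0.
have -> : sqnorm1 (metric_at g x) (coord g x) 0 = 0.
  by rewrite -(scale0r 0) sqnorm1Z expr0n mul0r.
by rewrite addr0 -[in X in Num.sqrt (_ + X)](scale0r 0) sqnorm1Z expr0n mul0r !addr0.
Qed.

Lemma norm_dN f x : smooth g f -> norm_d g (fun x => - f x) x = norm_d g f x.
Proof.
move=> sf; rewrite /norm_d /sqnorm_d (differentialN (sf _) (coord_cimg x)).
by rewrite -scaleN1r sqnorm1Z sqrrN expr1n mul1r.
Qed.

Lemma norm_dB f1 f2 x : smooth g f1 -> smooth g f2 ->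
  norm_d g (fun x => f1 x - f2 x) x <= norm_d g f1 x + norm_d g f2 x.
Proof.
move=> s1 s2; rewrite -(norm_dN x s2); apply: norm_dD => //; exact: smoothN.
Qed.

Lemma norm_d_cst (c : R) x : norm_d g (cst c) x = 0.
Proof.
rewrite /norm_d /sqnorm_d (_ : differential _ _ = 0 *: 0); last first.
  by apply/rowP => j; rewrite scaler0 !mxE; exact: derive_cst.
by rewrite sqnorm1Z expr0n mul0r sqrtr0.
Qed.

Lemma lap_tr f x : smooth g f -> lap g f x =
  tr2 (metric_at g x) (coord g x) (hessian (metric_at g x) (local g f x) (coord g x)).
Proof.
move=> sf.
exact: (laplacian_hessian (@oimg x) (@sG x) (@pG x) (sf _) (coord_cimg x)).
Qed.

Lemma tr2D (G : 'rV[R]_m -> 'M[R]_m) y S T : tr2 G y (S + T) = tr2 G y S + tr2 G y T.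
Proof.
rewrite /tr2 -big_split; apply: eq_bigr => i _; rewrite -big_split.
by apply: eq_bigr => j _; rewrite mxE mulrDr.
Qed.

Lemma tr2N (G : 'rV[R]_m -> 'M[R]_m) y S : tr2 G y (- S) = - tr2 G y S.
Proof.
rewrite /tr2 -sumrN; apply: eq_bigr => i _; rewrite -sumrN.
by apply: eq_bigr => j _; rewrite mxE mulrN.
Qed.

Lemma lapB f1 f2 x : smooth g f1 -> smooth g f2 ->
  lap g (fun x => f1 x - f2 x) x = lap g f1 x - lap g f2 x.
Proof.
move=> s1 s2; rewrite !lap_tr//; last exact: smoothB.
rewrite -tr2N -tr2D -(hessianN _ (@oimg x) (s2 _) (coord_cimg x)).
by rewrite -(hessianD _ (@oimg x) (s1 _) (smoothN s2 _) (coord_cimg x)).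
Qed.

Lemma lapM f1 f2 x : smooth g f1 -> smooth g f2 ->
  lap g (fun x => f1 x * f2 x) x = f1 x * lap g f2 x + f2 x * lap g f1 x +
  2 * dot1 (metric_at g x) (coord g x) (differential (local g f1 x) (coord g x))
    (differential (local g f2 x) (coord g x)).
Proof.
move=> s1 s2; rewrite /lap.
rewrite (laplacianM (@oimg x) (@sG x) (@pG x) (s1 _) (s2 _) (coord_cimg x)).
by rewrite /local /= coordK.
Qed.

Lemma cnormE h x : cnorm h x = Num.sqrt (re h x ^+ 2 + im h x ^+ 2).
Proof. by rewrite /cnorm /re /im; case: (h x). Qed.

Lemma reD h k : re (fun x => h x + k x) = (fun x => re h x + re k x).
Proof. by apply/funext => x; rewrite /re; case: (h x) (k x) => a b []. Qed.
Lemma imD h k : im (fun x => h x + k x) = (fun x => im h x + im k x).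
Proof. by apply/funext => x; rewrite /im; case: (h x) (k x) => a b []. Qed.
Lemma reN h : re (fun x => - h x) = (fun x => - re h x).
Proof. by apply/funext => x; rewrite /re; case: (h x). Qed.
Lemma imN h : im (fun x => - h x) = (fun x => - im h x).
Proof. by apply/funext => x; rewrite /im; case: (h x). Qed.

(** Multiplication by a real function, written by components so that [re] and [im] of the product
    are real products by conversion. *)
Definition cmul chi h x : R[i] := (chi x * re h x +i* (chi x * im h x))%C.

Lemma cmulB chi1 chi2 h x :
  cmul (fun x => chi1 x - chi2 x) h x = cmul chi1 h x - cmul chi2 h x.
Proof. by rewrite /cmul !mulrBl. Qed.

Lemma cmul1 h x : cmul (cst 1) h x = h x.
Proof. by rewrite /cmul /re /im !mul1r; case: (h x). Qed.

Lemma csmoothD h k : csmooth g h -> csmooth g k -> csmooth g (fun x => h x + k x).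
Proof. by move=> [? ?] [? ?]; split; rewrite ?reD ?imD; exact: smoothD. Qed.

Lemma csmoothN h : csmooth g h -> csmooth g (fun x => - h x).
Proof. by move=> [? ?]; split; rewrite ?reN ?imN; exact: smoothN. Qed.

Lemma csmoothB h k : csmooth g h -> csmooth g k -> csmooth g (fun x => h x - k x).
Proof. by move=> sh sk; apply: csmoothD => //; exact: csmoothN. Qed.

Lemma csmooth_cmul chi h : smooth g chi -> csmooth g h -> csmooth g (cmul chi h).
Proof. by move=> ? [? ?]; split; exact: smoothM. Qed.

Lemma cnorm_ge0 h x : 0 <= cnorm h x. Proof. by rewrite cnormE sqrtr_ge0. Qed.
Lemma cnorm_d_ge0 h x : 0 <= cnorm_d g h x. Proof. exact: sqrtr_ge0. Qed.
Lemma cnorm_hess_ge0 h x : 0 <= cnorm_hess g h x. Proof. exact: sqrtr_ge0. Qed.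
Lemma cnorm_lap_ge0 h x : 0 <= cnorm_lap g h x. Proof. exact: sqrtr_ge0. Qed.

Lemma cnormD h k x : cnorm (fun x => h x + k x) x <= cnorm h x + cnorm k x.
Proof. exact: le_normcD. Qed.

Lemma cnormN h x : cnorm (fun x => - h x) x = cnorm h x.
Proof. exact: normcN. Qed.

Lemma cnorm_dD h k x : csmooth g h -> csmooth g k ->
  cnorm_d g (fun x => h x + k x) x <= cnorm_d g h x + cnorm_d g k x.
Proof.
move=> [sh sh'] [sk sk']; rewrite /cnorm_d reD imD /sqnorm_d.
rewrite (differentialD (sh _) (sk _) (coord_cimg x)).
rewrite (differentialD (sh' _) (sk' _) (coord_cimg x)).
exact: norm1_triangle.
Qed.

Lemma cnorm_dN h x : csmooth g h -> cnorm_d g (fun x => - h x) x = cnorm_d g h x.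
Proof.
move=> [sh sh']; rewrite /cnorm_d reN imN /sqnorm_d.
rewrite (differentialN (sh _) (coord_cimg x)) (differentialN (sh' _) (coord_cimg x)).
have scN (v : 'rV[R]_m) : - v = (-1) *: v by rewrite scaleN1r.
by rewrite !scN norm1Z// normrN normr1 mul1r.
Qed.

Lemma cnorm_hessD h k x : csmooth g h -> csmooth g k ->
  cnorm_hess g (fun x => h x + k x) x <= cnorm_hess g h x + cnorm_hess g k x.
Proof.
move=> [sh sh'] [sk sk']; rewrite /cnorm_hess reD imD /sqnorm_hess.
rewrite (hessianD _ (@oimg x) (sh _) (sk _) (coord_cimg x)).
rewrite (hessianD _ (@oimg x) (sh' _) (sk' _) (coord_cimg x)).
exact: norm2_triangle.
Qed.

Lemma cnorm_hessN h x : csmooth g h ->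
  cnorm_hess g (fun x => - h x) x = cnorm_hess g h x.
Proof.
move=> [sh sh']; rewrite /cnorm_hess reN imN /sqnorm_hess.
rewrite (hessianN _ (@oimg x) (sh _) (coord_cimg x)).
rewrite (hessianN _ (@oimg x) (sh' _) (coord_cimg x)).
have sqN (T : 'M[R]_m) G y : sqnorm2 G y (- T) = sqnorm2 G y T.
  do 4! [apply: eq_bigr => ? _]; rewrite !mxE; ring.
by rewrite !sqN.
Qed.

Lemma cnorm_cmul chi h x : cnorm (cmul chi h) x = `|chi x| * cnorm h x.
Proof. by rewrite !cnormE sqrt_sqrZ. Qed.

Lemma cnorm_d_cmul chi h x : smooth g chi -> csmooth g h ->
  cnorm_d g (cmul chi h) x <= `|chi x| * cnorm_d g h x + norm_d g chi x * cnorm h x.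
Proof.
move=> sc [sh sh']; rewrite /cnorm_d /sqnorm_d.
rewrite (differentialM (sc _) (sh _) (coord_cimg x)).
rewrite (differentialM (sc _) (sh' _) (coord_cimg x)).
apply: le_trans (norm1_triangle _ _ _ _ _) _ => //.
rewrite norm1Z// norm1_scalars// /= coordK cnormE.
by rewrite [X in _ <= _ + X]mulrC.
Qed.

(** The Leibniz rule in which the Laplacian of [h], as a trace, is already bounded by its Hessian:
    only the latter is known to lie in L^q. *)
Lemma cnorm_lap_cmul chi h x : smooth g chi -> csmooth g h ->
  cnorm_lap g (cmul chi h) x <=
  `|chi x| * (Num.sqrt m%:R * cnorm_hess g h x) +
  2 * (norm_d g chi x * cnorm_d g h x) + `|lap g chi x| * cnorm h x.
Proof.
move=> sc [sh sh']; rewrite /cnorm_lap.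
rewrite -[re (cmul _ _)]/(fun x => chi x * re h x).
rewrite -[im (cmul _ _)]/(fun x => chi x * im h x) !lapM// cnormE.
rewrite addrAC [in X in _ + X ^+ 2]addrAC.
apply: le_trans (sqrt_sqrD_triangle _ _ _ _) _; apply: lerD; last first.
  by rewrite ![_ * lap _ _ _]mulrC sqrt_sqrZ.
apply: le_trans (sqrt_sqrD_triangle _ _ _ _) _; apply: lerD.
  rewrite sqrt_sqrZ ler_wpM2l// !lap_tr//; exact: norm_tr2_le.
rewrite sqrt_sqrZ ger0_norm// ler_wpM2l//; exact: norm_dot1_le.
Qed.

Lemma near_eq_sqnorm_hess f1 f2 x : (\forall z \near x, f1 z = f2 z) ->
  sqnorm_hess g f1 x = sqnorm_hess g f2 x.
Proof.
(* The inverse chart is continuous, so agreement near [x] is agreement on an open set of coordinates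
   around [coord g x]. *)
move=> f12; pose V : set 'rV[R]_m :=
  (cinv (atlas g (chart_at g x)) @^-1` [set z | f1 z = f2 z])^°.
have Vx : V (coord g x).
  have cc : {for coord g x, continuous (cinv (atlas g (chart_at g x)))}.
    by apply: cinv_continuous; rewrite inE; exact: coord_cimg.
  by apply: cc; rewrite coordK.
have oV : open V by exact: open_interior.
have E : {in V, local g f1 x =1 local g f2 x}.
  by move=> z; rewrite inE => /interior_subset.
by rewrite /sqnorm_hess (eq_hessian (metric_at g x) oV Vx E).
Qed.

Lemma near_eq_cnorm_hess h k x : (\forall z \near x, h z = k z) ->
  cnorm_hess g h x = cnorm_hess g k x.
Proof.
move=> hk; rewrite /cnorm_hess (@near_eq_sqnorm_hess (re h) (re k)).
  rewrite (@near_eq_sqnorm_hess (im h) (im k))//.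
  by apply: filterS hk => z; rewrite /im => ->.
by apply: filterS hk => z; rewrite /re => ->.
Qed.

(** A small closed ball of coordinates is compact, and so is its image under the inverse chart; that
    image is a neighbourhood because the chart is continuous. *)
Lemma compact_nbhs x : exists2 K : set M, compact K & nbhs x K.
Proof.
set c := atlas g (chart_at g x).
have [e e0 ce] : exists2 e : R, 0 < e & closed_ball (coord g x) e `<=` cimg c.
  have : nbhs (coord g x) (cimg c).
    by apply: open_nbhs_nbhs; split; [exact: cimg_open|exact: coord_cimg].
  by move=> /nbhs_closedballP[e ?]; exists e%:num.
exists (cinv c @` closed_ball (coord g x) e).
  apply: continuous_compact.
    apply: continuous_in_subspaceT => y; rewrite inE => /ce yc.
    by apply: cinv_continuous; rewrite inE.
  apply: bounded_closed_compact; last exact: closed_ball_closed.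
  rewrite closed_ballE//; exists (`|coord g x| + e); split; first exact: num_real.
  move=> r er y; rewrite /closed_ball_/= => ye; apply: le_trans (ltW er).
  rewrite -[y](subKr (coord g x)); apply: le_trans (ler_normB _ _) _.
  by rewrite lerD2l.
have dx : nbhs x (cdom c).
  by apply: open_nbhs_nbhs; split; [exact: cdom_open|exact: chart_atP].
have cx : nbhs x (cmap c @^-1` closed_ball (coord g x) e).
  have cc : {for x, continuous (cmap c)}.
    by apply: cmap_continuous; rewrite inE; exact: chart_atP.
  apply: cc; apply: filterS (nbhsx_ballx _ _ e0) => y; exact: subset_closed_ball.
apply: filterS2 dx cx => z dz cz.
by exists (cmap c z) => //; apply: cmapK; rewrite inE.
Qed.

End Manifold.

(** * Measurability *)

Section Measurability.
Context {R : realType} {m : nat} {M : ptopologicalType} (g : riemannian R m M).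
Implicit Types (f : M -> R) (h : M -> R[i]).

Lemma open_measurable_borel (A : set (borel M)) : open (A : set M) -> measurable A.
Proof. by move=> oA; exact: sub_sigma_algebra. Qed.

(** [chart_at] picks the least admissible index, so the set is a chart domain minus the union of the
    earlier ones. *)
Lemma measurable_chart_at i : measurable ([set x | chart_at g x = i] : set (borel M)).
Proof.
have -> : [set x | chart_at g x = i] =
    cdom (atlas g i) `\` \bigcup_(j in [set j | (j < i)%N]) cdom (atlas g j).
  apply/seteqP; split=> x /=.
    move=> <-; split; first exact: chart_atP.
    rewrite /chart_at; case: ex_minnP => n _ min [j /= jn dj].
    by have := min j (asboolT dj); rewrite leqNgt jn.
  move=> [dx nx]; rewrite /chart_at; case: ex_minnP => n /asboolP dn min.
  apply/eqP; rewrite eqn_leq (min _ (asboolT dx)) leqNgt/=.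
  by apply/negP => ni; apply: nx; exists n.
apply: measurableD; first by apply: open_measurable_borel; exact: cdom_open.
by apply: bigcup_measurable => j _; apply: open_measurable_borel; exact: cdom_open.
Qed.

(** [F] may jump where [chart_at] changes its value. On each of the countably many measurable pieces
    with a fixed chart, it is the restriction of a function continuous on the chart domain. *)
Lemma measurable_chartwise (F : borel M -> R) (Phi : nat -> 'rV[R]_m -> R) :
  (forall i y, cimg (atlas g i) y -> {for y, continuous (Phi i)}) ->
  (forall x, F x = Phi (chart_at g x) (coord g x)) ->
  measurable_fun [set: borel M] F.
Proof.
move=> cPhi FE; apply: (measurability _ (RGenOpens.measurableE R)).
move=> _ [_ [a [b ->] <-]]; rewrite setTI.
set B := `]a, b[%classic.
have -> : F @^-1` B = \bigcup_i ([set x | chart_at g x = i] `&`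
    [set x | cdom (atlas g i) x /\ B (Phi i (cmap (atlas g i) x))]).
  apply/seteqP; split=> x /=.
    rewrite FE => Bx; exists (chart_at g x) => //; split=> //.
    by split=> //; exact: chart_atP.
  by move=> [i _ [/= ix [_]]]; rewrite FE -ix.
apply: bigcupT_measurable => i; apply: measurableI; first exact: measurable_chart_at.
apply: open_measurable_borel; rewrite openE => x [dx Bx].
have ndx : nbhs x (cdom (atlas g i)).
  by apply: open_nbhs_nbhs; split => //; exact: cdom_open.
have cx : {for x, continuous (cmap (atlas g i))}.
  by apply: cmap_continuous; rewrite inE.
have cP : {for cmap (atlas g i) x, continuous (Phi i)} by apply: cPhi; exists x.
have nB : nbhs (Phi i (cmap (atlas g i) x)) B.
  by apply: open_nbhs_nbhs; split => //; exact: interval_open.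
have := continuous_comp cx cP; move=> /(_ _ nB) nPB.
by apply: filterS2 ndx nPB.
Qed.

Lemma measurable_smooth f : smooth g f ->
  measurable_fun [set: borel M] (f : borel M -> R).
Proof.
move=> sf; apply: (@measurable_chartwise _ (fun i => f \o cinv (atlas g i))).
  by move=> i y iy; exact: smooth_on_continuous (sf i) iy.
by move=> x /=; rewrite coordK.
Qed.

Let sG i a b : smooth_on (cimg (atlas g i)) (fun y => metric g i y a b).
Proof. exact: metric_smooth. Qed.
Let pG i y : cimg (atlas g i) y -> posdef (metric g i y).
Proof. exact: posdef_metric. Qed.
Let oimg i : open (cimg (atlas g i)).
Proof. exact: cimg_open. Qed.

Lemma measurable_sqnorm_d f : smooth g f ->
  measurable_fun [set: borel M] (sqnorm_d g f : borel M -> R).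
Proof.
move=> sf; apply: (@measurable_chartwise _ (fun i y => sqnorm1 (metric g i) y
    (differential (f \o cinv (atlas g i)) y))) => // i y iy.
apply: smooth_on_continuous iy.
exact: (smooth_on_sqnorm_differential (@oimg i) (@sG i) (@pG i) (sf i)).
Qed.

Lemma measurable_sqnorm_hess f : smooth g f ->
  measurable_fun [set: borel M] (sqnorm_hess g f : borel M -> R).
Proof.
move=> sf; apply: (@measurable_chartwise _ (fun i y => sqnorm2 (metric g i) y
    (hessian (metric g i) (f \o cinv (atlas g i)) y))) => // i y iy.
apply: smooth_on_continuous iy.
exact: (smooth_on_sqnorm_hessian (@oimg i) (@sG i) (@pG i) (sf i)).
Qed.

Lemma measurable_lap f : smooth g f ->
  measurable_fun [set: borel M] (lap g f : borel M -> R).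
Proof.
move=> sf; apply: (@measurable_chartwise _ (fun i => laplacian (metric g i)
    (f \o cinv (atlas g i)))) => // i y iy.
apply: smooth_on_continuous iy.
exact: (smooth_on_laplacian (@oimg i) (@sG i) (@pG i) (sf i)).
Qed.

Lemma measurable_sqrt_comp (F : borel M -> R) : measurable_fun [set: borel M] F ->
  measurable_fun [set: borel M] (fun x => Num.sqrt (F x)).
Proof.
move=> mF; apply: (measurableT_comp _ mF).
by apply: continuous_measurable_fun; exact: sqrt_continuous.
Qed.

Lemma measurable_cnorm h : csmooth g h ->
  measurable_fun [set: borel M] (cnorm h : borel M -> R).
Proof.
move=> [sh sh'].
have -> : cnorm h = fun x => Num.sqrt (re h x ^+ 2 + im h x ^+ 2).
  by apply/funext => x; exact: cnormE.
apply: measurable_sqrt_comp; apply: measurable_funD;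
  apply: measurable_funX; exact: measurable_smooth.
Qed.

Lemma measurable_cnorm_d h : csmooth g h ->
  measurable_fun [set: borel M] (cnorm_d g h : borel M -> R).
Proof.
move=> [sh sh']; apply: measurable_sqrt_comp.
by apply: measurable_funD; exact: measurable_sqnorm_d.
Qed.

Lemma measurable_cnorm_hess h : csmooth g h ->
  measurable_fun [set: borel M] (cnorm_hess g h : borel M -> R).
Proof.
move=> [sh sh']; apply: measurable_sqrt_comp.
by apply: measurable_funD; exact: measurable_sqnorm_hess.
Qed.

Lemma measurable_cnorm_lap h : csmooth g h ->
  measurable_fun [set: borel M] (cnorm_lap g h : borel M -> R).
Proof.
move=> [sh sh']; apply: measurable_sqrt_comp; apply: measurable_funD;
  apply: measurable_funX; exact: measurable_lap.
Qed.

End Measurability.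

(** * The norm of H^{2,q} *)

Lemma ctest_cmul (R : realType) m (M : topologicalType) (g : riemannian R m M)
    (chi : M -> R) (h : M -> R[i]) (B : set M) :
  smooth g chi -> csmooth g h -> compact B -> closed B ->
  [set x | chi x != 0] `<=` B -> ctest g (cmul chi h).
Proof.
move=> sc sh cB clB sB; split; first exact: csmooth_cmul.
apply: (subclosed_compact (@closed_closure _ _) cB).
rewrite [X in _ `<=` X](closure_id B).1//; apply: closureS => x /= cx; apply: sB => /=.
by apply: contra_neq cx => c0; rewrite /cmul c0 !mul0r.
Qed.

(** Turns (C3) and (C4), limits of extended suprema, into uniform pointwise bounds. *)
Lemma near_ereal_sup_le (R : realType) (T : Type) (u : nat -> T -> R) :
  ereal_sup [set (u n x)%:E | x in [set: T]] @[n --> \oo] --> 0%E ->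
  forall e, 0 < e -> \forall n \near \oo, forall x, u n x <= e.
Proof.
move=> u0 e e0.
have e0' : (0%E < e%:E :> \bar R)%E by rewrite lte_fin.
have near_e : \forall n \near \oo,
    (ereal_sup [set (u n x)%:E | x in [set: T]] < e%:E)%E.
  exact: (u0 _ (open_ereal_lt' e0')).
near=> n => x; rewrite -lee_fin; apply: ltW; apply: le_lt_trans (near near_e n _) => //.
by apply: ereal_sup_ubound; exists x.
Unshelve. all: by end_near. Qed.

Section Norms.
Context {R : realType} {m : nat} {M : ptopologicalType} (g : riemannian R m M).
Variables (mu : {measure set (borel M) -> \bar R}) (q : R).
Hypothesis q1 : 1 < q.
Implicit Types (F : M -> R) (h k l : M -> R[i]).
Local Open Scope ereal_scope.

Local Notation N F := (Lq mu q F).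

Lemma Lq_ge0 F : 0 <= N F. Proof. exact: Lnorm_ge0. Qed.

Lemma Lq_le F G : measurable_fun [set: borel M] (F : borel M -> R) ->
  measurable_fun [set: borel M] (G : borel M -> R) ->
  (forall x, 0 <= F x)%R -> (forall x, F x <= G x)%R -> N F <= N G.
Proof.
by move=> mF mG F0 FG; apply: (Lnorm_mono mu q1 mF mG) => x; rewrite ger0_norm.
Qed.

Lemma LqD F G : measurable_fun [set: borel M] (F : borel M -> R) ->
  measurable_fun [set: borel M] (G : borel M -> R) ->
  N (fun x => F x + G x)%R <= N F + N G.
Proof. by move=> mF mG; apply: (minkowski_EFin mu mF mG); exact: ltW. Qed.

Lemma LqZ F (c : R) : measurable_fun [set: borel M] (F : borel M -> R) ->
  (0 <= c)%R -> N (fun x => c * F x)%R = c%:E * N F.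
Proof. exact: Lnorm_scale. Qed.

(** [Q] stands for each of the three pointwise norms that make up [norm2q]; their triangle
    inequality is combined with Minkowski's. *)
Lemma Lq_subadditive (Q : (M -> R[i]) -> M -> R) h k :
  (forall h, csmooth g h -> measurable_fun [set: borel M] (Q h : borel M -> R)) ->
  (forall h x, (0 <= Q h x)%R) ->
  (forall h k x, csmooth g h -> csmooth g k ->
    (Q (fun x => h x + k x)%R x <= Q h x + Q k x)%R) ->
  csmooth g h -> csmooth g k ->
  N (Q (fun x => h x + k x)%R) <= N (Q h) + N (Q k).
Proof.
move=> mQ Q0 QD sh sk; apply: le_trans (LqD (mQ _ sh) (mQ _ sk)).
apply: Lq_le => //; first by apply: mQ; exact: csmoothD.
- by apply: measurable_funD; exact: mQ.
- by move=> x; exact: QD.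
Qed.

Lemma norm2qD h k : csmooth g h -> csmooth g k ->
  norm2q g mu q (fun x => h x + k x)%R <= norm2q g mu q h + norm2q g mu q k.
Proof.
move=> sh sk; rewrite /norm2q [leRHS]addeACA [X in _ <= X + _]addeACA.
apply: leeD; [apply: leeD|]; apply: Lq_subadditive => //.
- exact: measurable_cnorm.
- by move=> ? ?; exact: cnorm_ge0.
- by move=> *; exact: cnormD.
- exact: measurable_cnorm_d.
- by move=> ? ?; exact: cnorm_d_ge0.
- by move=> *; exact: cnorm_dD.
- exact: measurable_cnorm_hess.
- by move=> ? ?; exact: cnorm_hess_ge0.
- by move=> *; exact: cnorm_hessD.
Qed.

Lemma norm2qN h : csmooth g h -> norm2q g mu q (fun x => - h x)%R = norm2q g mu q h.
Proof.
move=> sh; rewrite /norm2q; congr (N _ + N _ + N _); apply/funext => x.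
- exact: cnormN.
- exact: cnorm_dN.
- exact: cnorm_hessN.
Qed.

Lemma norm2q_triangle h k l : csmooth g h -> csmooth g k -> csmooth g l ->
  norm2q g mu q (fun x => h x - k x)%R <=
  norm2q g mu q (fun x => h x - l x)%R + norm2q g mu q (fun x => l x - k x)%R.
Proof.
move=> sh sk sl; have -> : (fun x => h x - k x)%R =
    (fun x => (h x - l x) + (l x - k x))%R by apply/funext => x; rewrite subrKA.
by apply: norm2qD; exact: csmoothB.
Qed.

Lemma norm2q_ge0 h : 0 <= norm2q g mu q h.
Proof. by rewrite /norm2q !adde_ge0 ?Lq_ge0. Qed.

Lemma smooth2qP h : smooth2q g mu q h <-> csmooth g h /\ norm2q g mu q h < +oo.
Proof.
rewrite /norm2q; split=> [[sh h0 h1 h2]|[sh hoo]].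
  by split=> //; rewrite !lte_add_pinfty.
split=> //; apply: le_lt_trans hoo; rewrite -?addeA.
- by rewrite leeDl// adde_ge0// Lq_ge0.
- by rewrite addeCA leeDl// adde_ge0// Lq_ge0.
- by rewrite addeA leeDr// adde_ge0// Lq_ge0.
Qed.

End Norms.

(** * Truncation *)

Section Density.
Context {R : realType} {m : nat} {M : ptopologicalType} (g : riemannian R m M).
Variables (mu : {measure set (borel M) -> \bar R}) (q : R).
Hypothesis q1 : 1 < q.
Variable chi : nat -> M -> R.
Hypothesis cut : laplacian_cutoffs g chi.
Implicit Types (F : M -> R) (h : M -> R[i]).
Local Open Scope ereal_scope.

Local Notation N F := (Lq mu q F).

Let schi n : smooth g (chi n). Proof. by have [/(_ n)[]] := cut. Qed.

Let schiB j n : smooth g (fun x => chi j x - chi n x)%R.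
Proof. exact: smoothB. Qed.

Let seta n : smooth g (fun x => 1 - chi n x)%R.
Proof. by apply: smoothB => //; exact: smooth_cst. Qed.

Let mabs f : smooth g f -> measurable_fun [set: borel M] (fun x : borel M => `|f x|)%R.
Proof. by move=> sf; apply: measurableT_comp => //; exact: measurable_smooth. Qed.

(** One threshold serves a whole neighbourhood, by (C2) on a compact one; second derivatives at [x]
    require this. *)
Lemma cutoff_near (x : M) : \forall j \near \oo, \forall z \near x, chi j z = 1%R.
Proof.
have [K cK xK] := compact_nbhs g x; have [_ _ /(_ K cK)[n0 H] _ _] := cut.
by exists n0 => // j n0j; apply: filterS xK => z; exact: H.
Qed.

(** Applied with [F] the pointwise norm of [h], of its differential and of its Hessian. *)
Lemma Lq_remainder F (e : R) : measurable_fun [set: borel M] (F : borel M -> R) ->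
  N F < +oo -> (0 < e)%R ->
  \forall n \near \oo, N (fun x => `|1 - chi n x| * F x)%R <= e%:E.
Proof.
move=> mF Foo e0; have [_ chi01 _ _ _] := cut.
apply: (@Lnorm_dominated _ _ _ mu q q1 (fun n x => `|1 - chi n x|)%R) => //.
- by move=> n; exact: mabs.
- move=> n x; rewrite normr_id; have /andP[c0 c1] := chi01 n x.
  by rewrite ger0_norm ?subr_ge0// gerBl.
- move=> x; apply: filterS (cutoff_near x) => n /nbhs_singleton ->.
  by rewrite subrr normr0.
Qed.

Lemma ctest_cutoffB j n h : csmooth g h ->
  ctest g (cmul (fun x => chi j x - chi n x)%R h).
Proof.
move=> sh; have [sc _ _ _ _] := cut.
apply: (@ctest_cmul _ _ _ _ _ _
  (closure [set x | chi j x != 0%R] `|` closure [set x | chi n x != 0%R])) => //.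
- by apply: compactU; [exact: (sc j).2|exact: (sc n).2].
- by apply: closedU; exact: closed_closure.
- move=> x /= cx; have [cj|cj] := eqVneq (chi j x) 0%R.
    right; apply: subset_closure => /=; apply: contra_neq cx => cn.
    by rewrite cj cn subrr.
  by left; apply: subset_closure.
Qed.

Lemma ctest_cutoff n h : csmooth g h -> ctest g (cmul (chi n) h).
Proof.
move=> sh; have [sc _ _ _ _] := cut.
apply: (@ctest_cmul _ _ _ _ _ _ (closure [set x | chi n x != 0%R])) => //.
- exact: (sc n).2.
- exact: closed_closure.
- exact: subset_closure.
Qed.

Lemma Lq_hess_cutoff_cauchy h (e : R) : calderon_zygmund g mu q ->
  smooth2q g mu q h -> (0 < e)%R ->
  exists n0, forall j n, (n0 <= j)%N -> (n0 <= n)%N ->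
    N (cnorm_hess g (cmul (fun x => chi j x - chi n x)%R h)) <= e%:E.
Proof.
move=> [C [D [C0 D0 cz]]] [sh h0oo h1oo h2oo] e0.
have mh0 := measurable_cnorm sh; have mh1 := measurable_cnorm_d sh.
have mh2 := measurable_cnorm_hess sh.
have fin F : N F < +oo -> N F = (fine (N F))%:E.
  by move=> Foo; rewrite fineK// ge0_fin_numE ?Lq_ge0.
have fin0 F : (0 <= fine (N F))%R by rewrite fine_ge0// Lq_ge0.
pose s : R := Num.sqrt m%:R; have s0 : (0 <= s)%R by exact: sqrtr_ge0.
pose n0 := fine (N (cnorm h)); pose n1 := fine (N (cnorm_d g h)).
(* Suppose that [e'] bounds the differentials and Laplacians of both cut-offs and the two remainder
   norms. The difference of the cut-offs then gives twice each bound, the Leibniz rule doubles the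
   mixed term again, and Calderon-Zygmund gives [e' * K] in total. *)
pose K : R := (C * (s * 2 + (4 * n1 + 2 * n0)) + D * 2)%R.
have K0 : (0 <= K)%R.
  by rewrite addr_ge0 ?mulr_ge0 ?addr_ge0 ?mulr_ge0 ?fin0// ltW.
(* The added 1 keeps the denominator positive, as [K] is only known to be nonnegative. *)
pose e' : R := (e / (K + 1))%R.
have e'0 : (0 < e')%R by rewrite divr_gt0// ltr_wpDl.
have e'K : (e' * K <= e)%R.
  rewrite /e' mulrAC ler_pdivrMr ?ltr_wpDl// ler_wpM2l ?lerDl//.
  exact: ltW.
have [_ _ _ dchi lchi] := cut.
have near_d := near_ereal_sup_le dchi e'0.
have near_l := near_ereal_sup_le lchi e'0.
have near_0 := Lq_remainder mh0 h0oo e'0.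
have near_2 := Lq_remainder mh2 h2oo e'0.
have : \forall n \near \oo, [/\ forall x, (norm_d g (chi n) x <= e')%R,
    forall x, (`|lap g (chi n) x| <= e')%R,
    N (fun x => `|1 - chi n x| * cnorm h x)%R <= e'%:E &
    N (fun x => `|1 - chi n x| * cnorm_hess g h x)%R <= e'%:E].
  by near=> n; split; near: n.
move=> [n_0 _ P]; exists n_0 => j n /P[dj lj j0 j2] /P[dn ln_ nn0 nn2].
pose th x : R := (chi j x - chi n x)%R.
have sth : smooth g th by exact: schiB.
(* [th] is also a difference of the remainders [1 - chi], to which dominated convergence applies. *)
have th_le x : (`|th x| <= `|1 - chi j x| + `|1 - chi n x|)%R.
  rewrite /th (_ : _ - _ = (1 - chi n x) - (1 - chi j x))%R; last by ring.
  by rewrite [leRHS]addrC ler_normB.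
have meta i : measurable_fun [set: borel M] (fun x : borel M => `|1 - chi i x|)%R.
  exact: mabs.
have mM F i : measurable_fun [set: borel M] (F : borel M -> R) ->
    measurable_fun [set: borel M] (fun x : borel M => `|1 - chi i x| * F x)%R.
  by move=> mF; exact: measurable_funM.
have mZ F (c : R) : measurable_fun [set: borel M] (F : borel M -> R) ->
    measurable_fun [set: borel M] (fun x : borel M => c * F x)%R.
  by move=> mF; apply: measurable_funM.
have mD F G : measurable_fun [set: borel M] (F : borel M -> R) ->
    measurable_fun [set: borel M] (G : borel M -> R) ->
    measurable_fun [set: borel M] (fun x : borel M => F x + G x)%R.
  by move=> mF mG; exact: measurable_funD.
have lap_le : N (cnorm_lap g (cmul th h)) <= (e' * (s * 2 + (4 * n1 + 2 * n0)))%:E.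
  (* Two kinds of smallness: the factors [1 - chi] in [G1] are not uniformly small, and its norm is
     controlled by dominated convergence; the coefficients in [G2] are uniformly small, against
     fixed finite norms. *)
  pose G1 x := (s * (`|1 - chi j x| * cnorm_hess g h x +
                     `|1 - chi n x| * cnorm_hess g h x))%R.
  pose G2 x := (4 * e' * cnorm_d g h x + 2 * e' * cnorm h x)%R.
  have mG1 : measurable_fun [set: borel M] (G1 : borel M -> R).
    by apply: mZ; apply: mD; apply: mM.
  have mG2 : measurable_fun [set: borel M] (G2 : borel M -> R).
    by apply: mD; apply: mZ.
  apply: (@le_trans _ _ (N (fun x => G1 x + G2 x)%R)).
    apply: Lq_le => //.
    - by apply: measurable_cnorm_lap; exact: csmooth_cmul.
    - exact: mD mG1 mG2.
    - by move=> x; exact: cnorm_lap_ge0.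
    move=> x; apply: le_trans (cnorm_lap_cmul _ sth sh) _.
    rewrite -addrA; apply: lerD.
      rewrite /G1 -mulrDl -/s mulrCA ler_wpM2l// ler_wpM2r// cnorm_hess_ge0//.
    apply: lerD.
      rewrite mulrA ler_wpM2r ?cnorm_d_ge0//.
      have -> : (4 * e' = 2 * (e' + e'))%R by ring.
      rewrite ler_wpM2l//; apply: le_trans (norm_dB _ _ _) _ => //.
      by rewrite lerD.
    rewrite ler_wpM2r ?cnorm_ge0// lapB//; apply: le_trans (ler_normB _ _) _.
    by rewrite mulrDl mul1r lerD.
  apply: le_trans (LqD mu q1 mG1 mG2) _.
  rewrite mulrDr EFinD; apply: leeD.
    rewrite LqZ//; last by apply: mD; apply: mM.
    rewrite mulrCA EFinM lee_wpmul2l ?lee_fin//.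
    apply: le_trans (LqD mu q1 (mM _ _ mh2) (mM _ _ mh2)) _.
    by rewrite mulrDr mulr1 EFinD leeD.
  apply: le_trans (LqD mu q1 (mZ _ _ mh1) (mZ _ _ mh0)) _.
  have e'4 : (0 <= 4 * e')%R by rewrite mulr_ge0// ltW.
  have e'2 : (0 <= 2 * e')%R by rewrite mulr_ge0// ltW.
  rewrite (LqZ mu q1 mh1 e'4) (LqZ mu q1 mh0 e'2) (fin _ h0oo) (fin _ h1oo).
  rewrite -!EFinM -EFinD lee_fin.
  by rewrite -/n0 -/n1 le_eqVlt; apply/orP; left; apply/eqP; ring.
have zero_le : N (cnorm (cmul th h)) <= (e' * 2)%:E.
  apply: (@le_trans _ _ (N (fun x => `|1 - chi j x| * cnorm h x +
    `|1 - chi n x| * cnorm h x)%R)).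
    apply: Lq_le => //.
    - by apply: measurable_cnorm; exact: csmooth_cmul sth sh.
    - by apply: mD; apply: mM.
    - by move=> x; exact: cnorm_ge0.
    by move=> x; rewrite cnorm_cmul -mulrDl ler_wpM2r// cnorm_ge0.
  apply: le_trans (LqD mu q1 (mM _ _ mh0) (mM _ _ mh0)) _.
  by rewrite mulrDr mulr1 EFinD leeD.
(* The single application of the Calderon-Zygmund inequality; both of its right-hand norms have been
   bounded above. *)
apply: le_trans (cz _ (ctest_cutoffB j n sh)) _.
apply: (@le_trans _ _ ((C * (e' * (s * 2 + (4 * n1 + 2 * n0)))) + D * (e' * 2))%:E%R).
  by rewrite EFinD !EFinM leeD// lee_wpmul2l// lee_fin ltW.
rewrite lee_fin; apply: le_trans e'K.
by rewrite le_eqVlt; apply/orP; left; apply/eqP; rewrite /K; ring.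
Unshelve. all: by end_near. Qed.

Lemma Lq_hess_remainder h (e : R) : calderon_zygmund g mu q ->
  smooth2q g mu q h -> (0 < e)%R ->
  \forall n \near \oo, N (cnorm_hess g (cmul (fun x => 1 - chi n x)%R h)) <= e%:E.
Proof.
move=> cz hh e0; have [sh _ _ _] := hh.
have [n0 P] := Lq_hess_cutoff_cauchy cz hh e0.
exists n0 => // n n0n.
apply: (@Lnorm_le_fatou _ _ _ mu q q1
    (fun j => cnorm_hess g (cmul (fun x => chi j x - chi n x)%R h))).
- exact: ltW.
- by move=> j; apply: measurable_cnorm_hess; exact: csmooth_cmul.
(* For fixed [n] and large [j], the function with factor [chi j - chi n] coincides near [x] with the
   remainder, so their Hessian norms at [x] are equal. *)
- move=> x; apply: filterS (cutoff_near x) => j jx.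
  by apply: near_eq_cnorm_hess; apply: filterS jx => z; rewrite /cmul => ->.
- by exists n0 => // j n0j; exact: P.
Qed.

Lemma cutoff_approx h (e : R) : calderon_zygmund g mu q ->
  smooth2q g mu q h -> (0 < e)%R ->
  exists n, norm2q g mu q (fun x => h x - cmul (chi n) h x)%R <= e%:E.
Proof.
move=> cz hh e0; have [sh h0oo h1oo h2oo] := hh.
have mh0 := measurable_cnorm sh; have mh1 := measurable_cnorm_d sh.
have e4 : (0 < e / 4)%R by rewrite divr_gt0.
pose n0 := fine (N (cnorm h)).
have n0E : N (cnorm h) = n0%:E by rewrite fineK// ge0_fin_numE ?Lq_ge0.
have n0_ge0 : (0 <= n0)%R by rewrite fine_ge0// Lq_ge0.
(* Chosen so that [e' * n0] is at most [e / 4], including when [n0] is zero. *)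
pose e' : R := (e / 4 / (n0 + 1))%R.
have e'0 : (0 < e')%R by rewrite divr_gt0// ltr_wpDl.
have [_ _ _ dchi _] := cut.
have near_d := near_ereal_sup_le dchi e'0.
have near_0 := Lq_remainder mh0 h0oo e4.
have near_1 := Lq_remainder mh1 h1oo e4.
have near_2 := Lq_hess_remainder cz hh e4.
have : \forall n \near \oo, norm2q g mu q (fun x => h x - cmul (chi n) h x)%R <= e%:E.
  near=> n.
  have -> : (fun x => h x - cmul (chi n) h x)%R = cmul (fun x => 1 - chi n x)%R h.
    by apply/funext => x; rewrite (cmulB (cst 1%R)) cmul1.
  (* One quarter for the function, two for the two Leibniz terms of the differential, one for the
     Hessian. *)
  have -> : e%:E = (e / 4 + (e / 4 + e / 4) + e / 4)%:E by congr EFin; field.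
  rewrite /norm2q EFinD; apply: leeD; last by near: n.
  rewrite EFinD; apply: leeD.
    rewrite (_ : cnorm _ = fun x => `|1 - chi n x| * cnorm h x)%R; first by near: n.
    by apply/funext => x; rewrite cnorm_cmul.
  have m1 : measurable_fun [set: borel M]
      (fun x : borel M => `|1 - chi n x| * cnorm_d g h x)%R.
    by apply: measurable_funM => //; exact: mabs.
  have m2 : measurable_fun [set: borel M] (fun x : borel M => e' * cnorm h x)%R.
    exact: measurable_funM.
  apply: (@le_trans _ _ (N (fun x =>
      `|1 - chi n x| * cnorm_d g h x + e' * cnorm h x)%R)).
    apply: Lq_le => //.
    - by apply: measurable_cnorm_d; exact: csmooth_cmul.
    - exact: measurable_funD.
    - by move=> x; exact: cnorm_d_ge0.
    move=> x; apply: le_trans (cnorm_d_cmul _ (seta n) sh) _.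
    rewrite lerD2l ler_wpM2r ?cnorm_ge0//.
    apply: le_trans (norm_dB _ (smooth_cst g 1) (schi n)) _.
    by rewrite norm_d_cst add0r; move: x; near: n.
  apply: le_trans (LqD mu q1 m1 m2) _; rewrite EFinD; apply: leeD; first by near: n.
  rewrite (LqZ mu q1 mh0 (ltW e'0)) n0E -EFinM lee_fin.
  rewrite /e' mulrAC ler_pdivrMr ?ltr_wpDl//.
  by rewrite ler_wpM2l ?ltW// ltrDl.
by move=> [n _ /(_ n (leqnn n))]; exists n.
Unshelve. all: by end_near. Qed.

End Density.

(** * Density *)

(** The one-sided inequality is a full Cauchy condition, since [j] and [k] may be exchanged; in this
    form it avoids subtraction in the extended reals. *)
Lemma ereal_cauchy_cvg (R : realType) (a : nat -> \bar R) :
  (forall j, a j \is a fin_num) ->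
  (forall e : R, 0 < e -> exists N, forall j k, (N <= j)%N -> (N <= k)%N ->
    (a j <= a k + e%:E)%E) ->
  cvgn a.
Proof.
move=> fa ca.
have : cvgn (fine \o a).
  apply/cauchy_cvgP; apply: cauchy_exP => e e0.
  (* Halving turns the weak inequalities of the hypothesis into the strict one that defines a
     ball. *)
  have e2 : 0 < e / 2 by rewrite divr_gt0.
  have [N HN] := ca _ e2.
  exists (fine (a N)); exists N => // k Nk /=.
  have : fine (a N) <= fine (a k) + e / 2.
    by rewrite -lee_fin EFinD !fineK//; exact: HN.
  have : fine (a k) <= fine (a N) + e / 2.
    by rewrite -lee_fin EFinD !fineK//; exact: HN.
  rewrite /ball/= => ? ?; rewrite ltr_norml; apply/andP; split; lra.
move=> /cvg_ex[l al]; apply/cvg_ex; exists l%:E.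
by apply/fine_cvgP; split=> //; exact: nearW.
Qed.

(** * Distances in the completion *)

Section Completion.
Context {R : realType} {m : nat} {M : ptopologicalType} (g : riemannian R m M).
Variables (mu : {measure set (borel M) -> \bar R}) (q : R).
Hypothesis q1 : 1 < q.
Local Open Scope ereal_scope.

Lemma smooth2qB h k : smooth2q g mu q h -> smooth2q g mu q k ->
  smooth2q g mu q (fun x => h x - k x)%R.
Proof.
move=> /smooth2qP[sh hoo] /smooth2qP[sk koo]; apply/smooth2qP; split.
  exact: csmoothB.
have := norm2qD mu q1 sh (csmoothN sk).
rewrite (norm2qN mu q sk). move/le_lt_trans; apply. 
exact: lte_add_pinfty hoo koo.
Qed.

(** [limn] is the limit only of a convergent sequence, so the norms are first shown to converge: by
    the triangle inequality they inherit the Cauchy property of [w]. The bound then passes to the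
    limit. *)
Lemma H2q_dist_le (w : H2q g mu q) h (e : R) j : smooth2q g mu q h ->
  (forall k, (j <= k)%N -> norm2q g mu q (fun x => H2q_seq w k x - h x)%R <= e%:E) ->
  H2q_dist w h <= e%:E.
Proof.
move=> hh we; apply: lime_le; last by exists j.
have sw k := H2q_smooth w k.
have [sh _] := (smooth2qP g mu q h).1 hh.
have csw k : csmooth g (H2q_seq w k) by have [] := sw k.
apply: ereal_cauchy_cvg.
  move=> k; rewrite ge0_fin_numE ?norm2q_ge0//.
  by have /smooth2qP[] := smooth2qB (sw k) hh.
move=> d d0; have [N HN] := H2q_cauchy w d0; exists N => i k Ni Nk.
apply: le_trans (norm2q_triangle mu q1 (csw i) sh (csw k)) _.
rewrite [leRHS]addeC; exact: (leeD (ltW (HN i k Ni Nk)) (lexx _)).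
Qed.

End Completion.

Theorem theorem2p6 (R : realType) (m : nat) (M : ptopologicalType)
    (hausdorffM : hausdorff_space M) (connectedM : connected [set: M])
    (g : riemannian R m M)
    (mu : {measure set (borel M) -> \bar R}) (volmu : volume_measure g mu)
    (q : R) (q_gt1 : 1 < q)
    (cutoffs : exists chi : nat -> M -> R, laplacian_cutoffs g chi)
    (CZ : calderon_zygmund g mu q) :
  dense_in_H2q g mu q (ctest g).
Proof.
have [chi cut] := cutoffs; move=> w e e0.
have e4 : 0 < e / 4 by rewrite divr_gt0.
(* The term of index [N] is within [e / 4] of all later terms of the sequence, so truncating this
   smooth function is enough. *)
have [N HN] := H2q_cauchy w e4.
pose h := H2q_seq w N; have hh : smooth2q g mu q h by exact: H2q_smooth.
have [sh _] := (smooth2qP g mu q h).1 hh.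
have [n hn] := cutoff_approx q_gt1 cut CZ hh e4.
have tphi : ctest g (cmul (chi n) h) by exact (ctest_cutoff cut n sh).
have sphi : smooth2q g mu q (cmul (chi n) h).
  (* Finiteness of the norm of the truncation comes from writing it as [h] minus the remainder,
     whose norm is at most [e / 4]. *)
  have hr : smooth2q g mu q (fun x => h x - cmul (chi n) h x).
    apply/smooth2qP; split; last exact: le_lt_trans hn (ltry _).
    by apply: csmoothB => //; exact: tphi.1.
  have := smooth2qB q_gt1 hh hr.
  by under eq_fun do rewrite subKr.
exists (cmul (chi n) h); split=> //.
(* The limit preserves only weak inequalities; a total of [e / 2] leaves room for the strict one. *)
apply: (@le_lt_trans _ _ (e / 4 + e / 4)%:E); last by rewrite lte_fin; lra.
apply: (H2q_dist_le q_gt1 (j := N) sphi) => k Nk.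
have [sk _] := (smooth2qP g mu q _).1 (H2q_smooth w k).
apply: le_trans (norm2q_triangle mu q_gt1 sk tphi.1 sh) _.
rewrite EFinD; exact: (leeD (ltW (HN k N Nk (leqnn N))) hn).
Qed.
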